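(* Let $\{H_n\}_{n=1}^\infty$ be a Positive Linear Recurrence Sequence. Then every positive integer may be written uniquely as a legal sum $\sum_i a_i H_i$ (that is, has a unique legal decomposition). For each $n$, let $K_n$ be the number of summands in the legal decomposition of an integer chosen uniformly at random from $\Omega_n=\{H_n, H_n+1,\dots,H_{n+1}-1\}$, and let $\mathcal{K}_n=K_n-1$. Then $\mathbb{E}[K_n]$ and $\mathrm{Var}(K_n)$ are of order $n$, and as $n\to\infty$, $K_n$ (and $\mathcal{K}_n$) converges to a Gaussian; that is, $(K_n-\mathbb{E}[K_n])/\sqrt{\mathrm{Var}(K_n)}$, which equals the corresponding normalization of $\mathcal{K}_n$, converges in distribution to the standard normal.
   Context: A sequence $\{H_n\}_{n=1}^\infty$ of positive integers is a Positive Linear Recurrence Sequence if: (1) there are non-negative integers $L,c_1,\dots,c_L$, with $L$, $c_1$ and $c_L$ positive, such that $H_{n+1}=c_1H_n+\cdots+c_LH_{n+1-L}$ (for $n\ge L$); and (2) $H_1=1$, and for $1\le n<L$ we have $H_{n+1}=c_1H_n+c_2H_{n-1}+\cdots+c_nH_1+1$. A decomposition $\sum_{i=1}^m a_iH_{m+1-i}$ of a positive integer $N$ (and the sequence $\{a_i\}_{i=1}^m$) is called legal, recursively, if $a_1>0$, the other $a_i\ge 0$, and one of the following two conditions holds: (i) $m<L$ and $a_i=c_i$ for $1\le i\le m$; or (ii) there exists $s\in\{1,\dots,L\}$ such that $a_1=c_1,\ a_2=c_2,\ \dots,\ a_{s-1}=c_{s-1}$ and $a_s<c_s$, with $a_{s+1},\dots,a_{s+\ell}=0$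 for some $\ell\ge 0$, and the sequence $\{b_i\}_{i=1}^{m-s-\ell}$ with $b_i=a_{s+\ell+i}$ is legal or empty. The number of summands of a legal decomposition $\sum_{i=1}^m a_iH_{m+1-i}$ is $a_1+\cdots+a_m$. The uniform probability measure on $\Omega_n$ gives each of its $H_{n+1}-H_n$ elements weight $1/(H_{n+1}-H_n)$. Every integer in $\Omega_n$ has $H_n$ as a summand at least once, so $\mathcal{K}_n$ counts the non-forced summands.
   Formalization: The degenerate case L = 1, c_1 = 1 is excluded: there H_n = 1 for all n, every Ω_n is empty and no positive integer has a legal decomposition, so the claim fails as stated. *)

(* Defs.v *)
From HB Require Import structures.
From mathcomp Require Import all_boot all_order all_algebra.
From mathcomp Require Import all_classical all_reals all_analysis.
From mathcomp Require Import measurable_realfun finmap.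
Set Implicit Arguments.
Unset Strict Implicit.
Unset Printing Implicit Defensive.

Import Order.TTheory GRing.Theory Num.Theory.
Import numFieldNormedType.Exports.

Local Open Scope classical_set_scope.
Local Open Scope ring_scope.

(* The sequences [H] and [c] are indexed from 1 as functions on [nat]; only    *)
(* [H n] with [0 < n] and [c i] with [1 <= i <= L] are meaningful.             *)
Record is_PLRS (L : nat) (c H : nat -> nat) : Prop := IsPLRS {
  PLRS_L_gt0 : (0 < L)%N ;
  PLRS_c1_gt0 : (0 < c 1)%N ;
  PLRS_cL_gt0 : (0 < c L)%N ;
  PLRS_gt0 : forall n, (0 < n)%N -> (0 < H n)%N ;
  PLRS_rec : forall n, (L <= n)%N ->
    H n.+1 = (\sum_(1 <= i < L.+1) c i * H (n.+1 - i))%N ;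
  PLRS_H1 : H 1 = 1%N ;
  PLRS_init : forall n, (1 <= n < L)%N ->
    H n.+1 = (\sum_(1 <= i < n.+1) c i * H (n.+1 - i) + 1)%N }.

(* The coefficients a_1, ..., a_m are the list [a], so a_i is [nth 0 a i.-1]. *)
Inductive legal (L : nat) (c : nat -> nat) : seq nat -> Prop :=
| legal_prefix a :
    (0 < nth 0 a 0)%N ->
    (size a < L)%N ->
    (forall i, (1 <= i <= size a)%N -> nth 0%N a i.-1 = c i) ->
    legal L c a
| legal_block a s l :
    (0 < nth 0 a 0)%N ->
    (1 <= s <= L)%N ->
    (s + l <= size a)%N ->
    (forall i, (1 <= i < s)%N -> nth 0%N a i.-1 = c i) ->
    (nth 0 a s.-1 < c s)%N ->
    (forall i, (s < i <= s + l)%N -> nth 0%N a i.-1 = 0%N) ->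
    drop (s + l) a = [::] \/ legal L c (drop (s + l) a) ->
    legal L c a.

Definition decomposition_value (H : nat -> nat) (a : seq nat) : nat :=
  \sum_(1 <= i < (size a).+1) nth 0 a i.-1 * H ((size a).+1 - i).

Definition legal_decomposition_of (L : nat) (c H : nat -> nat) (N : nat)
    (a : seq nat) : Prop :=
  legal L c a /\ decomposition_value H a = N.

Definition legal_decomposition (L : nat) (c H : nat -> nat) (N : nat) :
    seq nat :=
  xget [::] [set a | legal_decomposition_of L c H N a].

Definition num_summands (L : nat) (c H : nat -> nat) (N : nat) : nat :=
  sumn (legal_decomposition L c H N).

Definition Omega (H : nat -> nat) (n : nat) : set nat :=
  [set N | (H n <= N < H n.+1)%N].

Section uniform_Omega.
Context (R : realType).

Lemma measurable_Omega H n : measurable (Omega H n).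
Proof. by []. Qed.

(* Counting measure on [Omega H n], normalized; the Dirac mass is the default  *)
(* that [mnormalize] requires and is used only when [Omega H n] is empty.      *)
Definition uniform_Omega (H : nat -> nat) (n : nat) : probability nat R :=
  mnormalize (mrestr counting (@measurable_Omega H n)) \d_(H n).

Lemma uniform_Omega_set1 H n N : N \in Omega H n ->
  uniform_Omega H n [set N] = ((H n.+1 - H n)%:R^-1)%:E.
Proof.
move=> NO; have finO : finite_set (Omega H n).
  apply: (@sub_finite_set _ _ `I_(H n.+1)); last exact: finite_II.
  by move=> x /= /andP[].
have cO : counting (Omega H n) = (H n.+1 - H n)%:R%:E :> \bar R.
  rewrite /counting asboolT//.
  have -> : fset_set (Omega H n) =
      [fset x | x in index_iota (H n) (H n.+1)]%fset.
    apply/fsetP => x; rewrite in_fset_set// !inE mem_index_iota.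
    by apply/idP/idP; rewrite in_setE.
  by rewrite card_fseq undup_id ?iota_uniq// size_iota.
have cN : counting [set N] = 1%:E :> \bar R.
  by rewrite /counting asboolT// fset_set1 cardfs1.
have /set_mem/= /andP[HN NH] := NO.
have H0 : (0 < H n.+1 - H n)%N by rewrite subn_gt0 (leq_ltn_trans HN).
rewrite /uniform_Omega/= /mnormalize/= /mrestr setTI cO.
rewrite eqe pnatr_eq0 -leqn0 leqNgt H0/= setIidl; last first.
  by move=> x /= ->; exact/set_mem.
by rewrite cN mul1e.
Qed.

End uniform_Omega.

Section standardize.
Context d (T : measurableType d) (R : realType) (P : probability T R).

Definition standardize (X : {RV P >-> R}) : T -> R :=
  fun w => (X w - fine 'E_P[X]) / Num.sqrt (fine 'V_P[X]).

Lemma measurable_standardize X : measurable_fun setT (standardize X).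
Proof.
by apply: measurable_funM => //; apply: measurable_funB.
Qed.

HB.instance Definition _ X := isMeasurableFun.Build _ _ _ _
  (standardize X) (measurable_standardize X).

End standardize.
Arguments standardize {d T R} P X.

Definition cvg_in_distribution d (T : measurableType d) (R : realType)
    (P : nat -> probability T R) (X : forall n, {RV P n >-> R})
    (mu : probability (measurableTypeR R) R) : Prop :=
  forall x : R, {for x, continuous (fun y : R => mu `]-oo, y]%classic)} ->
    cdf (X n) x @[n --> \oo] --> mu `]-oo, x]%classic.
Arguments cvg_in_distribution {d T R} P X mu.

Section summands.
Context (R : realType) (L : nat) (c H : nat -> nat).

Definition summands (N : nat) : R := (num_summands L c H N)%:R.

Definition nonforced_summands (N : nat) : R := summands N - 1.

Lemma measurable_summands : measurable_fun setT summands.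
Proof. by []. Qed.

Lemma measurable_nonforced_summands : measurable_fun setT nonforced_summands.
Proof. by []. Qed.

HB.instance Definition _ := isMeasurableFun.Build _ _ _ _
  summands measurable_summands.

HB.instance Definition _ := isMeasurableFun.Build _ _ _ _
  nonforced_summands measurable_nonforced_summands.

Definition summandsRV n : {RV uniform_Omega R H n >-> R} := summands.

Definition nonforced_summandsRV n : {RV uniform_Omega R H n >-> R} :=
  nonforced_summands.

End summands.

(* Main.v *)
(* A word of length m that is legal up to leading zeros is either a proper prefix
   of c_1 c_2 ... c_L or a block c_1 ... c_(s-1) j with j < c_s followed by such a
   word of length m - s.  In lexicographic order the words have values
   0, 1, ..., H_(m+1) - 1, which gives existence and uniqueness, and makes every
   sum over [0, H_(m+1)) of a function of the number of summands satisfy a renewal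
   recursion in m.  Let q in (0, 1) solve sum_s c_s q^s = 1, so that the weights
   q^s of the blocks form a probability distribution, with T the length and D the
   digit sum of a random block.  As the block 0 has length 1, solutions of the
   renewal recursion converge geometrically.  Applied to the weighted count and to
   the first two moments of K - mu m, where mu = E D / E T, this yields
   E K_n = mu n + O(1) and Var K_n = sigma^2 n + O(1) with
   sigma^2 = E (D - mu T)^2 / E T > 0.  The Gaussian limit comes from Lindeberg's
   replacement method run along the recursion: for smooth f the sum of
   f (x + K - mu m) is compared with the Gaussian mean of f (x + sigma sqrt m Z),
   which satisfies the same recursion up to a third order Taylor error by the
   semigroup property of Gaussians.  Half-lines are approximated by rescaled
   logistic functions. *)

Require Import Defs.
From HB Require Import structures.
From mathcomp Require Import all_boot all_order all_algebra.
From mathcomp Require Import all_classical all_reals all_analysis.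
From mathcomp Require Import measurable_realfun finmap ring lra zify.
Set Implicit Arguments.
Unset Strict Implicit.
Unset Printing Implicit Defensive.

Import Order.TTheory GRing.Theory Num.Theory.
Import numFieldNormedType.Exports.

Local Open Scope classical_set_scope.
Local Open Scope ring_scope.

(** * Words and their values *)

Section words.
Local Open Scope nat_scope.
Variables (L : nat) (c H : nat -> nat).
Hypothesis hH : is_PLRS L c H.
Implicit Types (a b w : seq nat) (m n s j z : nat).

(** The uniform measures themselves satisfy no exact recursion, because the ratios of successive
    [H n] are only asymptotically constant. So the proof works with unnormalised sums over a whole
    window [0, H_(m+1)), weighted by q^m, and divides by the weight of the shell only at the end.
    The price is that the total mass varies with m. This is why a geometric rate is needed: each
    replacement step costs the deviation of the mass from its limit times the Lipschitz constant F1
    of the test function, and these costs must be summable. The Taylor error is a multiple of the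
    third order constant F at every step, hence of m F in all. A test function living on the scale
    sqrt m has F1 of order m^(-1/2) and F of order m^(-3/2), so the total error F1 + m F is of order
    m^(-1/2). *)

Definition coef_prefix s : seq nat := [seq c i | i <- iota 1 s].

(** Words are grouped by the number [s] of digits that agree with c_1 c_2 ... before the first
    smaller digit [j]; this [s] is one less than the index in [legal_block]. The bare prefix comes
    last because it is the largest. The fuel replaces a recursion on the length that is not
    structural. *)
Fixpoint words_fuel n m : seq (seq nat) :=
  if n is n'.+1 then
    flatten [seq flatten [seq [seq coef_prefix s ++ j :: w | w <- words_fuel n' (m - s.+1)]
                         | j <- iota 0 (c s.+1)] | s <- iota 0 (minn m L)]
    ++ (if m < L then [:: coef_prefix m] else [::])
  else [::].

(* Legal words of length [m] with leading zeros allowed, listed in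
   lexicographic order. *)
Definition words m := words_fuel m.+1 m.

Lemma words_fuelE n m : m < n -> words_fuel n m = words m.
Proof.
elim/ltn_ind: n m => -[//|n] IH m mn; rewrite /words /=; congr (flatten _ ++ _).
apply/eq_in_map => s; rewrite mem_iota add0n leq_min => /and3P[_ sm sL].
congr flatten; apply: eq_map => j; congr map.
rewrite (IH n)//; last by rewrite ltn_subLR//; move: mn; clear; lia.
by rewrite IH//; move: mn sm; clear; lia.
Qed.

Lemma wordsE m : words m =
  flatten [seq flatten [seq [seq coef_prefix s ++ j :: w | w <- words (m - s.+1)]
                       | j <- iota 0 (c s.+1)] | s <- iota 0 (minn m L)]
  ++ (if m < L then [:: coef_prefix m] else [::]).
Proof.
rewrite {1}/words /=; congr (flatten _ ++ _).
apply/eq_in_map => s; rewrite mem_iota add0n leq_min => /and3P[_ sm sL].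
congr flatten; apply: eq_map => j; congr map.
by rewrite words_fuelE// ltn_subrL; move: sm; clear; lia.
Qed.

Lemma size_coef_prefix s : size (coef_prefix s) = s.
Proof. by rewrite size_map size_iota. Qed.

Lemma nth_coef_prefix s i : i < s -> nth 0 (coef_prefix s) i = c i.+1.
Proof. by move=> si; rewrite (nth_map 0) ?size_iota// nth_iota// add1n. Qed.

Lemma mem_words_block m s j w : s < m -> s < L -> j < c s.+1 ->
  w \in words (m - s.+1) -> coef_prefix s ++ j :: w \in words m.
Proof.
move=> sm sL jc wm; rewrite wordsE mem_cat; apply/orP; left.
apply/flattenP; eexists.
  by apply/mapP; exists s; [rewrite mem_iota add0n leq_min sm sL|reflexivity].
apply/flattenP; eexists.
  by apply/mapP; exists j; [rewrite mem_iota|reflexivity].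
by apply/mapP; exists w.
Qed.

Lemma mem_words_prefix m : m < L -> coef_prefix m \in words m.
Proof. by move=> mL; rewrite wordsE mL mem_cat inE eqxx orbT. Qed.

Lemma words_inv m w : w \in words m -> (m < L /\ w = coef_prefix m) \/
  exists s j w', [/\ s < m, s < L, j < c s.+1, w' \in words (m - s.+1) &
    w = coef_prefix s ++ j :: w'].
Proof.
rewrite wordsE mem_cat => /orP[|]; last first.
  by case: ifP => // mL; rewrite inE => /eqP ->; left.
move=> /flattenP[_ /mapP[s + ->]] /flattenP[_ /mapP[j + ->]] /mapP[w' w'm ->].
rewrite !mem_iota !add0n leq_min => /= /andP[sm sL] jc.
by right; exists s, j, w'.
Qed.

Lemma size_words m w : w \in words m -> size w = m.
Proof.
elim/ltn_ind: m w => m IH w /words_inv[[_ ->]|[s [j [w' [sm sL _ /IH sz ->]]]]].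
  exact: size_coef_prefix.
rewrite size_cat size_coef_prefix/= sz; first by move: sm; clear; lia.
by rewrite ltn_subrL; move: sm; clear; lia.
Qed.

Lemma words_cons0 m w : w \in words m -> 0 :: w \in words m.+1.
Proof.
move=> wm; rewrite -[0 :: w]/(coef_prefix 0 ++ 0 :: w); apply: mem_words_block => //.
- exact: PLRS_L_gt0 hH.
- exact: PLRS_c1_gt0 hH.
- by rewrite subn1.
Qed.

Lemma words_nseq0 m w z : w \in words m -> nseq z 0 ++ w \in words (z + m).
Proof. by move=> wm; elim: z => [//|z IH]; rewrite addSn /=; exact: words_cons0. Qed.

(** The [l] zeros of the gap are read as [l] blocks [0] of length one, which are allowed because c_1
    > 0. *)
Lemma legal_words a : legal L c a -> a \in words (size a).
Proof.
move: {2}(size a).+1 (ltnSn (size a)) => n.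
elim: n a => [//|n IH] a an la; case: la an => {a} [a a0 aL ac _|a s l a0].
  have -> : a = coef_prefix (size a); last by rewrite size_coef_prefix mem_words_prefix.
  apply: (@eq_from_nth _ 0); first by rewrite size_coef_prefix.
  by move=> i ia; rewrite nth_coef_prefix// -(ac i.+1).
case: s => [//|s] /andP[_ sL] sla ac acs a00 aleg an.
have sa : s < size a by move: sla; clear; lia.
have -> : a = coef_prefix s ++ nth 0 a s :: (nseq l 0 ++ drop (s.+1 + l) a).
  rewrite -[LHS](cat_take_drop s); congr (_ ++ _).
    apply: (@eq_from_nth _ 0); rewrite (size_takel (ltnW sa)) ?size_coef_prefix//.
    by move=> i i_s; rewrite nth_take// nth_coef_prefix// -(ac i.+1).
  rewrite (drop_nth 0 sa); congr (_ :: _).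
  rewrite -[LHS](cat_take_drop l) drop_drop addnC; congr (_ ++ _).
  have sl : l <= size (drop s.+1 a) by rewrite size_drop; move: sla; clear; lia.
  apply: (@eq_from_nth _ 0); rewrite (size_takel sl) ?size_nseq// => i il.
  rewrite nth_take// nth_nseq il nth_drop; apply: (a00 (s.+1 + i).+1).
  by move: il; clear; lia.
set w := nseq l 0 ++ _.
have -> : size (coef_prefix s ++ nth 0 a s :: w) = size a.
  rewrite size_cat size_coef_prefix /= size_cat size_nseq size_drop.
  by move: sla; clear; lia.
apply: mem_words_block => //.
have -> : size a - s.+1 = l + size (drop (s.+1 + l) a).
  by rewrite size_drop; move: sla; clear; lia.
apply: words_nseq0; case: aleg => [->|dl]; first exact: mem_words_prefix (PLRS_L_gt0 hH).
by apply: IH => //; rewrite size_drop; move: an sla; clear; lia.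
Qed.

(** A first block [0] is one more leading zero. Any other first block begins with a positive digit,
    and the leading zeros of the remaining word then form the gap [l] of [legal_block]. *)
Lemma words_legal m w : w \in words m ->
  exists z a, w = nseq z 0 ++ a /\ (a = [::] \/ legal L c a).
Proof.
have c1 := PLRS_c1_gt0 hH.
elim/ltn_ind: m w => m IH w /words_inv[[mL ->]|[s [j [w' [sm sL jc w'm ->]]]]].
  exists 0, (coef_prefix m); split=> //; case: m mL {IH} => [|m] mL; [by left|right].
  apply: legal_prefix => //; rewrite size_coef_prefix//.
  by move=> [//|i] /= im; rewrite nth_coef_prefix.
have [|z [a [w'E al]]] := IH (m - s.+1) _ _ w'm.
  by rewrite ltn_subrL; move: sm; clear; lia.
have [/andP[/eqP -> /eqP ->]|sj] := boolP ((s == 0) && (j == 0)).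
  by exists z.+1, a; rewrite w'E.
exists 0, (coef_prefix s ++ j :: w'); split=> //; right.
apply: (@legal_block _ _ _ s.+1 z).
- case: s sj {sm sL jc w'm} => [|s] //=; by rewrite lt0n.
- by rewrite sL.
- by rewrite size_cat size_coef_prefix/= w'E size_cat size_nseq; clear; lia.
- move=> [//|i] /=; rewrite ltnS => si.
  by rewrite nth_cat size_coef_prefix si nth_coef_prefix.
- by rewrite nth_cat size_coef_prefix /= ltnn subnn.
- move=> [//|i] /andP[si iz] /=.
  have si' : s <= i by rewrite -ltnS ltnW.
  rewrite nth_cat size_coef_prefix ltnNge si' /=.
  have -> : i - s = (i - s.+1).+1 by move: si; clear; lia.
  by rewrite /= w'E nth_cat size_nseq nth_nseq ifT ?if_same//; move: si iz; clear; lia.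
- rewrite drop_cat size_coef_prefix ltnNge (leq_trans (leqnSn s) (leq_addr _ _)) /=.
  have -> : s.+1 + z - s = z.+1 by clear; lia.
  by rewrite /= w'E drop_size_cat ?size_nseq.
Qed.

Notation dv := (decomposition_value H).

Lemma decomposition_value_nil : dv [::] = 0.
Proof. by rewrite /decomposition_value big_geq. Qed.

Lemma decomposition_value_cons x a : dv (x :: a) = x * H (size a).+1 + dv a.
Proof.
rewrite /decomposition_value /= big_ltn// subn1/=; congr (_ + _).
by rewrite big_add1 /=; apply: eq_big_nat => i /andP[i0 _]; case: i i0.
Qed.

Lemma decomposition_value_coef k s w :
  dv ([seq c i | i <- iota k s] ++ w) =
  \sum_(0 <= i < s) c (k + i) * H (s + size w - i) + dv w.
Proof.
elim: s k => [|s IH] k; first by rewrite big_geq.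
rewrite /= decomposition_value_cons IH size_cat size_map size_iota addnA.
rewrite big_nat_recl// addn0 subn0 addSn; congr (_ + _ + _).
by apply: eq_bigr => i _; rewrite addSnnS subSS.
Qed.

Lemma decomposition_value_nseq0 z w : dv (nseq z 0 ++ w) = dv w.
Proof. by elim: z => //= z IH; rewrite decomposition_value_cons IH. Qed.

Lemma flatten_iota k n i : flatten [seq iota (i + j * k) k | j <- iota 0 n] = iota i (n * k).
Proof.
elim: n => [//|n IH]; rewrite -addn1 iotaD map_cat flatten_cat IH /= cats0 add0n.
by rewrite mulnDl mul1n iotaD.
Qed.

(* Lexicographic order on words is the order of their values. *)
Lemma map_value_words m : [seq dv w | w <- words m] = iota 0 (H m.+1).
Proof.
elim/ltn_ind: m => m IH.
(* [base s] is the value of c_1 ... c_s followed by zeros; the words with fewer than [S] agreeing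
   digits take exactly the values below [base S]. *)
pose base s := \sum_(0 <= i < s) c i.+1 * H (m - i).
have blocks S : S <= minn m L ->
  [seq dv w | w <- flatten [seq flatten
     [seq [seq coef_prefix s ++ j :: w | w <- words (m - s.+1)]
                       | j <- iota 0 (c s.+1)] | s <- iota 0 S]] = iota 0 (base S).
  elim: S => [|S IHS] SmL; first by rewrite /base big_geq.
  rewrite -addn1 iotaD map_cat flatten_cat map_cat IHS ?(ltnW SmL)// add0n /= cats0.
  rewrite /base addn1 big_nat_recr//= iotaD add0n; congr (_ ++ _).
  rewrite map_flatten -map_comp -flatten_iota; congr flatten.
  move: SmL; rewrite leq_min => /andP[Sm SL].
  apply: eq_map => j /=; rewrite -map_comp.
  have -> : iota (base S + j * H (m - S)) (H (m - S)) =
     [seq base S + j * H (m - S) + v | v <- iota 0 (H (m - S))].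
    by rewrite -iotaDl addn0.
  have mS : m - S = (m - S.+1).+1 by move: Sm; clear; lia.
  rewrite [in X in iota 0 X]mS -(IH (m - S.+1)); last by move: Sm; clear; lia.
  rewrite -map_comp; apply/eq_in_map => w /size_words sw /=.
  rewrite /coef_prefix decomposition_value_coef decomposition_value_cons /= sw -mS.
  rewrite addnA; congr (_ + _ + _); apply: eq_bigr => i _; rewrite add1n; congr (_ * H _).
  by rewrite subnKC// ltnW.
(* For m < L the bare prefix has value [base m], which accounts for the [+ 1] in [PLRS_init]; for L
   <= m there is no bare prefix, and [base L] is the right side of [PLRS_rec]. *)
rewrite wordsE map_cat blocks//; have [mL|Lm] := ltnP m L.
  rewrite /= -[coef_prefix m]cats0 /coef_prefix.
  rewrite decomposition_value_coef decomposition_value_nil addn0 /=.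
  have -> : \sum_(0 <= i < m) c (1 + i) * H (m + 0 - i) = base m.
    by apply: eq_bigr => i _; rewrite addn0.
  rewrite -[[:: base m]]/(iota (0 + base m) 1) -iotaD; congr iota.
  case: m mL {IH blocks} @base => [|m] mL base; first by rewrite /base big_geq// (PLRS_H1 hH).
  by rewrite (PLRS_init hH)// big_add1.
by rewrite cats0 (PLRS_rec hH)// big_add1.
Qed.


Lemma value_words_inj m w1 w2 : w1 \in words m -> w2 \in words m ->
  dv w1 = dv w2 -> w1 = w2.
Proof.
have : uniq [seq dv w | w <- words m] by rewrite map_value_words iota_uniq.
move=> u w1m w2m e; have i1 := w1m; have i2 := w2m.
rewrite -index_mem in i1; rewrite -index_mem in i2.
rewrite -(nth_index [::] w1m) -(nth_index [::] w2m); congr nth; apply/eqP.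
rewrite -(nth_uniq 0 _ _ u) ?size_map//.
by rewrite !(nth_map [::])// !nth_index// e.
Qed.

Lemma legal_head_gt0 a : legal L c a -> 0 < nth 0 a 0.
Proof. by case. Qed.

Lemma legal_value_gt0 a : legal L c a -> 0 < dv a.
Proof.
move=> /legal_head_gt0; case: a => [//|x a] /= x0.
by rewrite decomposition_value_cons addn_gt0 muln_gt0 x0 (PLRS_gt0 hH).
Qed.

Lemma cat_nseq0_inj z1 z2 a1 a2 : 0 < nth 0 a1 0 -> 0 < nth 0 a2 0 ->
  nseq z1 0 ++ a1 = nseq z2 0 ++ a2 -> a1 = a2.
Proof.
move=> h1 h2; elim: z1 z2 => [|z1 IH] [|z2] //= e.
- by move: h1; rewrite e.
- by move: h2; rewrite -e.
- by apply: (IH z2); case: e.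
Qed.

(** The two sequences may differ in length. Padding each with as many zeros as the other has digits
    puts both among the words of one length, where values are distinct. *)
Lemma legal_value_inj a1 a2 : legal L c a1 -> legal L c a2 -> dv a1 = dv a2 -> a1 = a2.
Proof.
move=> l1 l2 e.
have w1 := words_nseq0 (size a2) (legal_words l1).
have w2 := words_nseq0 (size a1) (legal_words l2).
apply: (cat_nseq0_inj (legal_head_gt0 l1) (legal_head_gt0 l2)).
rewrite addnC in w2; apply: (value_words_inj w1 w2).
by rewrite !decomposition_value_nseq0.
Qed.

Lemma num_summands_words m w : w \in words m -> num_summands L c H (dv w) = sumn w.
Proof.
move=> /words_legal[z [a [-> al]]].
rewrite decomposition_value_nseq0 sumn_cat sumn_nseq mul0n add0n /num_summands.
case: al => [->|la].
  (* No legal sequence has value 0, so [xget] returns its default [[::]], whose digit sum 0 is that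
     of the zero word. *)
  rewrite decomposition_value_nil /legal_decomposition xgetPN// => b [lb b0].
  by have := legal_value_gt0 lb; rewrite b0.
congr sumn; apply: xget_unique => [|b [lb ba]]; first by split.
exact: legal_value_inj.
Qed.

Lemma sum_num_summands (V : nmodType) (g : nat -> V) m :
  (\sum_(0 <= N < H m.+1) g (num_summands L c H N) = \sum_(w <- words m) g (sumn w))%R.
Proof.
rewrite /index_iota subn0 -map_value_words big_map; apply: eq_big_seq => w wm.
by rewrite (num_summands_words wm).
Qed.

Definition coef_sum s := \sum_(0 <= i < s) c i.+1.

Lemma sumn_coef_prefix s : sumn (coef_prefix s) = coef_sum s.
Proof.
rewrite sumnE big_map -[s in iota 1 s]/(s.+1.-1) -subn1 -/(index_iota 1 s.+1).
by rewrite big_add1.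
Qed.

(** For L <= m no bare prefix occurs, so every word splits off a first block. The function [g] is
    arbitrary because masses, moments and test functions all pass through this recursion. *)
Lemma sum_num_summands_rec (V : nmodType) (g : nat -> V) m : L <= m ->
  (\sum_(0 <= N < H m.+1) g (num_summands L c H N) =
   \sum_(s < L) \sum_(j < c s.+1) \sum_(0 <= N < H (m - s.+1).+1)
     g (coef_sum s + j + num_summands L c H N)%N)%R.
Proof.
move=> Lm; rewrite sum_num_summands wordsE (minn_idPr Lm) ltnNge Lm /= cats0.
transitivity (\sum_(0 <= s < L) \sum_(0 <= j < c s.+1)
    \sum_(0 <= N < H (m - s.+1).+1) g (coef_sum s + j + num_summands L c H N)%N)%R;
  last by rewrite big_mkord; apply: eq_bigr => s _; rewrite big_mkord.
rewrite big_flatten big_map {1}/index_iota subn0; apply: eq_bigr => s _.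
rewrite big_flatten big_map {1}/index_iota subn0; apply: eq_bigr => j _.
rewrite big_map (sum_num_summands (fun x => g (coef_sum s + j + x))).
by apply: eq_bigr => w _; rewrite sumn_cat sumn_coef_prefix /= addnA.
Qed.

Hypothesis hLc : ~ (L = 1 /\ c 1 = 1).

(** The excluded case is the only one with coefficient sum 1; it would force q = 1 and a constant
    sequence [H]. *)
Lemma coef_sum_ge2 : 1 < coef_sum L.
Proof.
have L0 := PLRS_L_gt0 hH; have c1 := PLRS_c1_gt0 hH; have cL := PLRS_cL_gt0 hH.
have E : coef_sum L = \sum_(i < L) c i.+1 by rewrite /coef_sum big_mkord.
have [L1|L1] := eqVneq L 1.
  rewrite E L1 big_ord1; rewrite ltn_neqAle c1 andbT; apply/eqP => /esym c11.
  exact: hLc.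
have iL : L.-1 < L by rewrite ltn_predL.
rewrite E (bigD1 (Ordinal L0))//= (bigD1 (Ordinal iL))/=; last first.
  by rewrite -val_eqE /=; move: L1 L0; clear; lia.
by rewrite prednK//; move: c1 cL; clear; lia.
Qed.

Lemma PLRS_increasing n : 0 < n -> H n < H n.+1.
Proof.
move=> n0; have L0 := PLRS_L_gt0 hH; have c1 := PLRS_c1_gt0 hH.
have [nL|Ln] := ltnP n L.
  rewrite (PLRS_init hH) ?n0// big_ltn// subn1/= addn1 ltnS.
  by rewrite (leq_trans (leq_pmull _ c1))// leq_addr.
rewrite (PLRS_rec hH)// big_ltn// subn1/=.
have [L1|L1] := eqVneq L 1.
  rewrite L1 big_geq// addn0.
  have c12 : 1 < c 1 by rewrite ltn_neqAle c1 andbT; apply/eqP => /esym c11; exact: hLc.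
  by rewrite -[X in X < _]mul1n ltn_pmul2r// (PLRS_gt0 hH).
have L2 : 1 < L by rewrite ltn_neqAle eq_sym L1.
rewrite big_nat_recr//=.
have : 0 < c L * H (n.+1 - L) by rewrite muln_gt0 (PLRS_cL_gt0 hH) (PLRS_gt0 hH)// subn_gt0.
have : H n <= c 1 * H n by exact: leq_pmull.
by clear; lia.
Qed.

Lemma PLRS_gt_index n : n < H n.+1.
Proof.
elim: n => [|n IH]; first by rewrite (PLRS_H1 hH).
exact: leq_ltn_trans IH (PLRS_increasing _).
Qed.

Theorem legal_decomposition_exists_unique N : 0 < N ->
  exists! a, legal_decomposition_of L c H N a.
Proof.
move=> N0.
(* Words of length N suffice, since N < H_(N+1). *)
have : N \in [seq dv w | w <- words N].
  by rewrite map_value_words mem_iota PLRS_gt_index.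
move=> /mapP[w /words_legal[z [a [-> [->|la]]]]].
  by rewrite decomposition_value_nseq0 decomposition_value_nil => NE; rewrite NE in N0.
rewrite decomposition_value_nseq0 => NE; exists a; split; first by split.
by move=> b [lb bN]; apply: legal_value_inj => //; rewrite bN.
Qed.

End words.

(** * Renewal recursions *)

Section geometric_convergence.
Context {R : realType}.
Implicit Types (a b : nat -> R) (l k : R).

(** The rate is existential so that sums of sequences with different rates stay in the class. It is
    recorded because deviations from the limit are later added up over all steps. *)
Definition geom_cvg a l := exists M r : R,
  [/\ 0 <= M, 0 < r, r < 1 & forall m, `|a m - l| <= M * r ^+ m].

Lemma ler_exp_base (r s : R) m : 0 <= r -> r <= s -> r ^+ m <= s ^+ m.
Proof. by move=> r0 rs; rewrite lerXn2r// nnegrE// (le_trans r0). Qed.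

Lemma geom_cvg_eventually a l m0 M (r : R) : 0 < r -> r < 1 ->
  (forall m, (m0 <= m)%N -> `|a m - l| <= M * r ^+ m) -> geom_cvg a l.
Proof.
move=> r0 r1 h; pose G := \sum_(i < m0) `|a i - l| / r ^+ i.
have G0 : 0 <= G by apply: sumr_ge0 => i _; rewrite divr_ge0// exprn_ge0// ltW.
exists (`|M| + G), r; split => // [|m]; first by rewrite addr_ge0.
have rm : 0 < r ^+ m by rewrite exprn_gt0.
have [mm0|mm0] := ltnP m m0; last first.
  rewrite (le_trans (h m mm0))// ler_pM2r//.
  by rewrite (le_trans (ler_norm M))// lerDl.
rewrite -ler_pdivrMr// /G (bigD1 (Ordinal mm0))//=.
rewrite addrCA lerDl addr_ge0// sumr_ge0// => i _.
by rewrite divr_ge0// exprn_ge0// ltW.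
Qed.

Lemma geom_cvgD a b k l : geom_cvg a k -> geom_cvg b l ->
  geom_cvg (fun m => a m + b m) (k + l).
Proof.
move=> [M [r [M0 r0 r1 h]]] [N [s [N0 s0 s1 g]]].
exists (M + N), (Order.max r s); split.
- exact: addr_ge0.
- by rewrite lt_max r0.
- by rewrite gt_max r1.
- move=> m; rewrite opprD addrACA (le_trans (ler_normD _ _))// mulrDl lerD//.
    rewrite (le_trans (h m))// ler_wpM2l// (ler_exp_base _ (ltW r0))//.
    by rewrite le_max lexx.
  rewrite (le_trans (g m))// ler_wpM2l// (ler_exp_base _ (ltW s0))//.
  by rewrite le_max lexx orbT.
Qed.

Lemma geom_cvg_cst k : geom_cvg (fun=> k) k.
Proof.
exists 0, (1/2); split; [by []|lra|lra|].
by move=> m; rewrite subrr normr0 mul0r.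
Qed.

Lemma geom_cvgZ a k l : geom_cvg a l -> geom_cvg (fun m => k * a m) (k * l).
Proof.
move=> [M [r [M0 r0 r1 h]]]; exists (`|k| * M), r; split => //.
  exact: mulr_ge0.
by move=> m; rewrite -mulrBr normrM -mulrA ler_wpM2l.
Qed.

Lemma geom_cvg_sum (I : Type) (s : seq I) (a : I -> nat -> R) (l : I -> R) :
  (forall i, geom_cvg (a i) (l i)) ->
  geom_cvg (fun m => \sum_(i <- s) a i m) (\sum_(i <- s) l i).
Proof.
move=> h; elim: s => [|i s IH].
  rewrite big_nil (_ : (fun m => _) = fun=> 0); first exact: geom_cvg_cst.
  by apply/funext => m; rewrite big_nil.
rewrite big_cons (_ : (fun m => _) = fun m => a i m + \sum_(j <- s) a j m).
  exact: geom_cvgD.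
by apply/funext => m; rewrite big_cons.
Qed.

Lemma geom_cvg_subn a l t : geom_cvg a l -> geom_cvg (fun m => a (m - t)%N) l.
Proof.
move=> [M [r [M0 r0 r1 h]]]; exists (M / r ^+ t), r; split => //.
  by rewrite divr_ge0// exprn_ge0// ltW.
move=> m; rewrite (le_trans (h _))// -mulrA ler_wpM2l//.
rewrite mulrC ler_pdivlMr ?exprn_gt0// -exprD ler_wiXn2l// ?ltW//.
by rewrite addnC -leq_subLR.
Qed.

(** C r^m is the tail sum of the bounds on the increments, so a - C r^m increases and a + C r^m
    decreases from [m0] on. The supremum of the former is the limit, with error at most C r^m. *)
Lemma geom_cvg_increments a m0 M (r : R) : 0 < r -> r < 1 ->
  (forall m, (m0 <= m)%N -> `|a m.+1 - a m| <= M * r ^+ m) ->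
  exists l, geom_cvg a l.
Proof.
move=> r0 r1 h; pose C := M / (1 - r).
have r10 : 0 < 1 - r by rewrite subr_gt0.
have CE : C * (1 - r) = M by rewrite /C divfK// gt_eqF.
pose lo m := a (m0 + m)%N - C * r ^+ (m0 + m).
pose hi m := a (m0 + m)%N + C * r ^+ (m0 + m).
have stepE m : C * r ^+ m - C * r ^+ m.+1 = M * r ^+ m.
  by rewrite -CE exprS; ring.
have lo_nd m n : lo m <= lo (m + n)%N.
  elim: n => [|n IH]; first by rewrite addn0.
  apply: (le_trans IH); rewrite /lo !addnS.
  have := h (m0 + (m + n))%N (leq_addr _ _); have := stepE (m0 + (m + n))%N.
  by rewrite ler_norml => ? /andP[? ?]; lra.
have hi_ni m n : hi (m + n)%N <= hi m.
  elim: n => [|n IH]; first by rewrite addn0.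
  apply: (le_trans _ IH); rewrite /hi !addnS.
  have := h (m0 + (m + n))%N (leq_addr _ _); have := stepE (m0 + (m + n))%N.
  by rewrite ler_norml => ? /andP[? ?]; lra.
have M0 : 0 <= M.
  by have := le_trans (normr_ge0 _) (h m0 (leqnn _)); rewrite pmulr_lge0// exprn_gt0.
have C0 : 0 <= C by rewrite divr_ge0// ltW.
have lohi m n : lo m <= hi n.
  apply: (le_trans (lo_nd m n)); rewrite addnC; apply: (le_trans _ (hi_ni n m)).
  rewrite /lo /hi lerD2l; have : 0 <= C * r ^+ (m0 + (n + m)).
    by rewrite mulr_ge0// exprn_ge0// ltW.
  by lra.
pose E := [set lo m | m in setT].
have E0 : E !=set0 by exists (lo 0%N), 0%N.
have Eub : has_ubound E by exists (hi 0%N) => _ [m _ <-].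
exists (sup E); apply: (@geom_cvg_eventually _ _ m0 C r) => // m mm0.
have h1 : lo (m - m0)%N <= sup E by apply: ub_le_sup => //; exists (m - m0)%N.
have h2 : sup E <= hi (m - m0)%N by apply: ge_sup => // _ [n _ <-].
by move: h1 h2; rewrite /lo /hi subnKC// ler_norml => *; apply/andP; split; lra.
Qed.

End geometric_convergence.

Section renewal.
Context {R : realType} (B : finType) (T : B -> nat) (q : R) (b0 : B) (L : nat).
Hypothesis L_gt1 : (1 < L)%N.
Hypothesis T_bounds : forall b, (1 <= T b <= L)%N.
Hypothesis T_b0 : T b0 = 1%N.
Hypothesis q_gt0 : 0 < q.
Hypothesis q_lt1 : q < 1.
Hypothesis sum_q : \sum_b q ^+ T b = 1.
Implicit Types a : nat -> R.

Let qX_ge0 n : 0 <= q ^+ n. Proof. by rewrite exprn_ge0// ltW. Qed.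

(** The block [b0] of length one keeps a fraction q of the preceding value, and the other terms of
    the average are nonnegative up to the errors accumulated so far. A value [y] just before [m]
    thus survives through the window, losing a factor q and one [d] per step. *)
Lemma renewal_lower a (y d : R) m : (L <= m)%N -> 0 <= y -> 0 <= d ->
  (forall j, (m - L <= j < m)%N -> 0 <= a j) -> y <= a m.-1 ->
  (forall i, (i < L)%N -> \sum_b q ^+ T b * a (m + i - T b)%N - d <= a (m + i)%N) ->
  forall i, (i < L)%N -> q ^+ i.+1 * y - i.+1%:R * d <= a (m + i)%N.
Proof.
move=> Lm y0 d0 a0 ya h; elim/ltn_ind => i IH iL.
apply: le_trans (h i iL).
have lb b : - (i%:R * d) + (b == b0)%:R * (q ^+ i * y) <= a (m + i - T b)%N.
  have /andP[T1 TL] := T_bounds b.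
  have id0 : 0 <= i%:R * d by rewrite mulr_ge0.
  have [->|bb0] := eqVneq b b0; last first.
    rewrite mul0r addr0; have [Ti|Ti] := leqP (T b) i; last first.
      apply: (@le_trans _ _ 0); first by rewrite oppr_le0.
      by apply: a0; lia.
    rewrite -addnBA//; apply: le_trans (IH _ _ _); [|lia|lia].
    have : 0 <= q ^+ (i - T b).+1 * y by rewrite mulr_ge0.
    have : (i - T b).+1%:R * d <= i%:R * d by rewrite ler_wpM2r// ler_nat; lia.
    by lra.
  rewrite mul1r T_b0; case: i {h id0} iL IH => [_ _|i iL IH].
    by rewrite addn0 subn1 mul0r oppr0 add0r expr0 mul1r.
  by rewrite addnS subn1/= addrC; apply: IH => //; lia.
apply: (@le_trans _ _ (\sum_b q ^+ T b * (- (i%:R * d) + (b == b0)%:R * (q ^+ i * y)) - d)).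
  have -> : \sum_b q ^+ T b * (- (i%:R * d) + (b == b0)%:R * (q ^+ i * y)) =
     - (i%:R * d) + q ^+ i.+1 * y.
    under eq_bigr do rewrite mulrDr.
    rewrite big_split/= -mulr_suml sum_q mul1r; congr (_ + _).
    rewrite (bigD1 b0)//= eqxx mul1r T_b0 expr1 big1 ?addr0 ?exprS ?mulrA// => b /negbTE ->.
    by rewrite mul0r mulr0.
  by rewrite -addn1 natrD mulrDl mul1r; lra.
rewrite lerD2r; apply: ler_sum => b _; exact: ler_wpM2l.
Qed.

(** The last value before the window lies in the upper or the lower half of [u, v]. Accordingly
    [renewal_lower], applied to [a - u] or to [v - a], moves one of the two bounds inwards by q^L (v
    - u) / 2, up to errors. *)
Lemma renewal_window a (u v d : R) m : (L <= m)%N -> 0 <= d ->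
  (forall j, (m - L <= j < m)%N -> u <= a j <= v) ->
  (forall i, (i < L)%N ->
     `|a (m + i)%N - \sum_b q ^+ T b * a (m + i - T b)%N| <= d) ->
  exists u' v', [/\ forall i, (i < L)%N -> u' <= a (m + i)%N <= v',
    u - L%:R * d <= u', v' <= v + L%:R * d &
    v' - u' <= (1 - q ^+ L / 2) * (v - u) + 2 * L%:R * d].
Proof.
move=> Lm d0 auv h.
have uv : u <= v by have /andP[h1 h2] := auv m.-1 ltac:(lia); exact: le_trans h1 h2.
have low (y : R) : 0 <= y -> y <= a m.-1 - u -> forall i, (i < L)%N ->
    q ^+ L * y - L%:R * d <= a (m + i)%N - u.
  move=> y0 ya i iL.
  have := @renewal_lower (fun n => a n - u) y d m Lm y0 d0 _ ya _ i iL.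
  have hw : forall j : nat, (m - L <= j < m)%N -> 0 <= a j - u.
    by move=> j /auv/andP[? _]; rewrite subr_ge0.
  have hr : forall i : nat, (i < L)%N ->
    \sum_b q ^+ T b * (a (m + i - T b)%N - u) - d <= a (m + i)%N - u.
    move=> k kL; have := h k kL; rewrite ler_norml => /andP[+ _].
    under [X in X - d <= _]eq_bigr do rewrite mulrBr.
    by rewrite big_split/= sumrN -mulr_suml sum_q mul1r; lra.
  move=> /(_ hw hr); apply: le_trans.
  have : q ^+ L * y <= q ^+ i.+1 * y by rewrite ler_wpM2r// ler_wiXn2l// ltW.
  have : i.+1%:R * d <= L%:R * d by rewrite ler_wpM2r// ler_nat.
  by lra.
have upp (y : R) : 0 <= y -> y <= v - a m.-1 -> forall i, (i < L)%N ->
    q ^+ L * y - L%:R * d <= v - a (m + i)%N.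
  move=> y0 ya i iL.
  have := @renewal_lower (fun n => v - a n) y d m Lm y0 d0 _ ya _ i iL.
  have hw : forall j : nat, (m - L <= j < m)%N -> 0 <= v - a j.
    by move=> j /auv/andP[_ ?]; rewrite subr_ge0.
  have hr : forall i : nat, (i < L)%N ->
    \sum_b q ^+ T b * (v - a (m + i - T b)%N) - d <= v - a (m + i)%N.
    move=> k kL; have := h k kL; rewrite ler_norml => /andP[_ +].
    under [X in X - d <= _]eq_bigr do rewrite mulrBr.
    by rewrite big_split/= sumrN -mulr_suml sum_q mul1r; lra.
  move=> /(_ hw hr); apply: le_trans.
  have : q ^+ L * y <= q ^+ i.+1 * y by rewrite ler_wpM2r// ler_wiXn2l// ltW.
  have : i.+1%:R * d <= L%:R * d by rewrite ler_wpM2r// ler_nat.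
  by lra.
have qL0 : 0 <= q ^+ L by [].
have Ld0 : 0 <= L%:R * d by rewrite mulr_ge0.
have uv0 : 0 <= (v - u) / 2 by rewrite divr_ge0// subr_ge0.
have quv0 : 0 <= q ^+ L * ((v - u) / 2) by rewrite mulr_ge0.
have /andP[ua av] := auv m.-1 ltac:(lia).
have [mid|mid] := lerP ((v - u) / 2) (a m.-1 - u).
- exists (u + q ^+ L * ((v - u) / 2) - L%:R * d), (v + L%:R * d); split; try lra.
  move=> i iL; have := low _ uv0 mid i iL.
  have := upp 0 (lexx _) ltac:(lra) i iL; rewrite mulr0 => *.
  by apply/andP; split; lra.
- exists (u - L%:R * d), (v - q ^+ L * ((v - u) / 2) + L%:R * d); split; try lra.
  move=> i iL; have := upp _ uv0 ltac:(lra) i iL.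
  have := low 0 (lexx _) ltac:(lra) i iL; rewrite mulr0 => *.
  by apply/andP; split; lra.
Qed.

(** Serves to turn a contraction per [L] steps into a rate per single step. *)
Lemma bernoulli_lower (x : R) n : 0 <= x -> x <= 1 -> 1 - n%:R * x <= (1 - x) ^+ n.
Proof.
move=> x0 x1; elim: n => [|n IH]; first by rewrite mul0r subr0.
have n0 : 0 <= n%:R :> R by [].
have nx : 0 <= n%:R * x * x by rewrite !mulr_ge0.
rewrite exprS -addn1 natrD mulrDl mul1r.
apply: (@le_trans _ _ ((1 - x) * (1 - n%:R * x))); first by nra.
by rewrite ler_wpM2l// subr_ge0.
Qed.

(* The window oscillation shrinks by a fixed factor every [L] steps. *)
Theorem renewal_geom_cvg a e : geom_cvg e 0 ->
  (forall m, (L <= m)%N -> a m = \sum_b q ^+ T b * a (m - T b)%N + e m) ->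
  exists l, geom_cvg a l.
Proof.
move=> [K [rho [K0 rho0 rho1 eK]]] rec.
pose th := q ^+ L / 2; pose Lr : R := L%:R.
have Lr2 : 2 <= Lr by rewrite ler_nat.
have qL0 : 0 < q ^+ L by rewrite exprn_gt0.
have th0 : 0 < th by rewrite divr_gt0.
have th1 : th <= 1 / 2.
  by rewrite ler_pM2r ?invr_gt0// exprn_ile1// ltW.
(* With this [x], Bernoulli's inequality gives (1 - x)^L >= 1 - th / 2. The other half of the
   contraction [th] is kept for absorbing the error [e]. *)
pose x := th / (2 * Lr).
have x0 : 0 < x by rewrite divr_gt0// mulr_gt0//; lra.
have Lx : Lr * x = th / 2 by rewrite /x; field; rewrite gt_eqF//; lra.
have x1 : x < 1 by nra.
pose r := Order.max rho (1 - x).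
have r0 : 0 < r by rewrite lt_max rho0.
have r1 : r < 1 by rewrite gt_max rho1/=; lra.
have rhor m : rho ^+ m <= r ^+ m.
  by rewrite (ler_exp_base _ (ltW rho0))// le_max lexx.
have rL : 1 - th / 2 <= r ^+ L.
  apply: (@le_trans _ _ ((1 - x) ^+ L)).
    by rewrite -Lx bernoulli_lower// ltW.
  apply: ler_exp_base; first by lra.
  by rewrite le_max lexx orbT.
pose G := \sum_(j < 2 * L) `|a j|.
have aG j : (j < 2 * L)%N -> `|a j| <= G.
  by move=> jL; rewrite /G (bigD1 (Ordinal jL))//= lerDl sumr_ge0.
have G0 : 0 <= G by exact: sumr_ge0.
(* The first summand absorbs the error [e]; the second covers the starting windows, those with m < 2
   L. *)
pose M := 4 * Lr * K / th + 2 * G / r ^+ (2 * L).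
have r2L : 0 < r ^+ (2 * L) by rewrite exprn_gt0.
have M1 : 2 * G <= M * r ^+ (2 * L).
  rewrite /M [leRHS]mulrDl divfK ?gt_eqF// lerDr; apply: mulr_ge0; last exact: ltW.
  by apply: divr_ge0; [rewrite mulr_ge0//; lra|exact: ltW].
have M2 : 2 * Lr * K <= M * (th / 2).
  have -> : M * (th / 2) = 2 * Lr * K + G / r ^+ (2 * L) * th.
    by rewrite /M; field; rewrite !gt_eqF.
  by rewrite lerDl; apply: mulr_ge0 (ltW th0); exact: divr_ge0 (ltW r2L).
have M0 : 0 <= M.
  by rewrite -(pmulr_lge0 _ r2L) (le_trans _ M1)// mulr_ge0.
have eb m i : `|a (m + i)%N - \sum_b q ^+ T b * a (m + i - T b)%N| <= K * rho ^+ m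
    \/ (m < L)%N.
  have [|Lm] := ltnP m L; [by right|left].
  rewrite rec; last by rewrite (leq_trans Lm)// leq_addr.
  rewrite addrC addKr -[X in `|X|]subr0 (le_trans (eK _))// ler_wpM2l//.
  by rewrite (ler_wiXn2l (ltW rho0) (ltW rho1))// leq_addr.
have eb' m : (L <= m)%N -> forall i, (i < L)%N ->
    `|a (m + i)%N - \sum_b q ^+ T b * a (m + i - T b)%N| <= K * rho ^+ m.
  by move=> Lm i _; case: (eb m i) => //; rewrite ltnNge Lm.
have Krho m : 0 <= K * rho ^+ m by rewrite mulr_ge0// exprn_ge0// ltW.
have windows m : (L <= m)%N -> exists u v,
    (forall j, (m - L <= j < m)%N -> u <= a j <= v) /\ v - u <= M * r ^+ m.
  elim/ltn_ind: m => m IH Lm; have [m2L|m2L] := ltnP m (2 * L).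
    exists (- G), G; split=> [j /andP[_ jm]|].
      by rewrite -ler_norml aG// (ltn_trans jm).
    rewrite opprK; apply: (@le_trans _ _ (2 * G)); first by lra.
    by rewrite (le_trans M1)// ler_wpM2l// (ler_wiXn2l (ltW r0) (ltW r1))// ltnW.
  have Lm' : (L <= m - L)%N by move: m2L; clear; lia.
  have mLm : (m - L < m)%N by move: Lm L_gt1; clear; lia.
  have [u [v [uv vu]]] := IH (m - L)%N mLm Lm'.
  have [u' [v' [uv' _ _ vu']]] := renewal_window Lm' (Krho _) uv (eb' _ Lm').
  exists u', v'; split=> [j /andP[j1 j2]|].
    have jL : (j - (m - L) < L)%N by move: j1 j2 Lm; clear; lia.
    by have := uv' _ jL; rewrite subnKC.
  apply: (le_trans vu'); rewrite -/Lr -/th.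
  rewrite -{2}(subnK (leq_trans Lm' (leq_subr _ _))) exprD.
  have rm : 0 < r ^+ (m - L) by rewrite exprn_gt0.
  have Kr : K * rho ^+ (m - L) <= K * r ^+ (m - L) by rewrite ler_wpM2l.
  have h1 : (1 - th) * (v - u) <= (1 - th) * (M * r ^+ (m - L)).
    by rewrite ler_wpM2l//; lra.
  have h2 : 2 * Lr * (K * rho ^+ (m - L)) <= M * (th / 2) * r ^+ (m - L).
    apply: (@le_trans _ _ (2 * Lr * (K * r ^+ (m - L)))).
      by rewrite ler_wpM2l//; lra.
    by rewrite mulrA ler_wpM2r// ltW.
  have h3 : M * r ^+ (m - L) * (1 - th / 2) <= M * r ^+ (m - L) * r ^+ L.
    by rewrite ler_wpM2l// mulr_ge0// ltW.
  by rewrite mulrA; lra.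
(* The window before [m.+1] contains [a m], and the next one, which contains [a m.+1], exceeds
   [u, v] by at most L times the error. *)
apply: (@geom_cvg_increments _ _ L (M + Lr * K) r) => // m Lm.
have Lm' : (L <= m.+1)%N by exact: leqW.
have [u [v [uv vu]]] := windows _ Lm'.
have [u' [v' [uv' u'E v'E _]]] := renewal_window Lm' (Krho _) uv (eb' _ Lm').
have mw : (m.+1 - L <= m < m.+1)%N by move: L_gt1; clear; lia.
have := uv' 0%N (ltnW L_gt1); rewrite addn0 => /andP[? ?].
have /andP[? ?] := uv m mw.
have rS : r ^+ m.+1 <= r ^+ m by rewrite ler_wiXn2l// ltW.
have h1 : M * r ^+ m.+1 <= M * r ^+ m by rewrite ler_wpM2l.
have h2 : Lr * (K * rho ^+ m.+1) <= Lr * (K * r ^+ m).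
  by rewrite ler_wpM2l// ler_wpM2l// (le_trans (rhor _)).
rewrite /Lr in h2 *.
by rewrite ler_norml; apply/andP; split; lra.
Qed.

End renewal.

(** * Gaussian means *)

Section gaussian_expectation.
Context {R : realType}.
Implicit Types (f g : R -> R) (x y z t : R).
Notation mu := (@lebesgue_measure R).
Notation phi := (normal_pdf (0 : R) 1).

Definition gauss_integrable g :=
  mu.-integrable setT (EFin \o (fun z => g z * phi z)).

Definition gauss_mean g : R := \int[mu]_z (g z * phi z).

Lemma phi_ge0 z : 0 <= phi z. Proof. exact: normal_pdf_ge0. Qed.

Lemma gauss_integrable_le (h g : R -> R) : measurable_fun setT h ->
  (forall z, `|h z| <= g z) -> gauss_integrable g -> gauss_integrable h.
Proof.
move=> mh hg ig; apply: le_integrable ig => //=.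
  apply/measurable_EFinP/measurable_funM => //; exact: measurable_normal_pdf.
move=> z _; rewrite /= lee_fin !normrM ler_wpM2r// (le_trans (hg z))//.
exact: ler_norm.
Qed.

Lemma eq_gauss_integrable f g : f =1 g -> gauss_integrable f -> gauss_integrable g.
Proof. by move=> /funext ->. Qed.

Lemma gauss_integrableD f g : gauss_integrable f -> gauss_integrable g ->
  gauss_integrable (fun z => f z + g z).
Proof.
move=> fi gi; apply: eq_integrable (integrableD _ fi gi) => //.
by move=> z _ /=; rewrite mulrDl.
Qed.

Lemma gauss_integrableZ k f : gauss_integrable f ->
  gauss_integrable (fun z => k * f z).
Proof.
move=> fi; apply: eq_integrable (integrableZl _ k fi) => //.
by move=> z _ /=; rewrite -EFinM mulrA.
Qed.

Lemma gauss_integrable_cst k : gauss_integrable (fun=> k).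
Proof.
apply: eq_integrable (integrableZl _ k (integrable_normal_pdf 0 1)) => //.
Qed.

Lemma gauss_integrable_bounded (f : R -> R) k : measurable_fun setT f ->
  (forall z, `|f z| <= k) -> gauss_integrable f.
Proof. by move=> mf fk; exact: gauss_integrable_le mf fk (gauss_integrable_cst k). Qed.

Lemma gauss_meanD f g : gauss_integrable f -> gauss_integrable g ->
  gauss_mean (fun z => f z + g z) = gauss_mean f + gauss_mean g.
Proof.
move=> fi gi; rewrite /gauss_mean -RintegralD//.
by apply: eq_Rintegral => z _; rewrite mulrDl.
Qed.

Lemma gauss_meanZ k f : gauss_integrable f ->
  gauss_mean (fun z => k * f z) = k * gauss_mean f.
Proof.
move=> fi; rewrite /gauss_mean -RintegralZl//.
by apply: eq_Rintegral => z _; rewrite mulrA.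
Qed.

Lemma gauss_mean_cst k : gauss_mean (fun=> k) = k.
Proof.
rewrite /gauss_mean RintegralZl//; last exact: integrable_normal_pdf.
by rewrite /Rintegral integral_normal_pdf mulr1.
Qed.

Lemma gauss_mean_le f g : gauss_integrable f -> gauss_integrable g ->
  (forall z, f z <= g z) -> gauss_mean f <= gauss_mean g.
Proof.
move=> fi gi fg; apply: le_Rintegral => // z _.
by rewrite ler_wpM2r ?phi_ge0.
Qed.

Lemma gauss_meanB f g : gauss_integrable f -> gauss_integrable g ->
  gauss_mean (fun z => f z - g z) = gauss_mean f - gauss_mean g.
Proof.
move=> fi gi; rewrite /gauss_mean -RintegralB//.
by apply: eq_Rintegral => z _; rewrite mulrBl.
Qed.

Lemma gauss_mean_norm_le f g : measurable_fun setT f -> gauss_integrable g ->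
  (forall z, `|f z| <= g z) -> `|gauss_mean f| <= gauss_mean g.
Proof.
move=> mf gi fg; have fi := gauss_integrable_le mf fg gi.
rewrite ler_norml -mulN1r -gauss_meanZ//; apply/andP; split; apply: gauss_mean_le => //.
- exact: gauss_integrableZ.
- by move=> z; have := fg z; rewrite ler_norml mulN1r => /andP[].
- by move=> z; have := fg z; rewrite ler_norml => /andP[].
Qed.

Lemma gauss_integrable_sum (I : Type) (s : seq I) (g : I -> R -> R) :
  (forall i, gauss_integrable (g i)) -> gauss_integrable (fun z => \sum_(i <- s) g i z).
Proof.
move=> gi; elim: s => [|i s IH].
  rewrite (_ : (fun z => _) = fun=> 0); first exact: gauss_integrable_cst.
  by apply/funext => z; rewrite big_nil.
rewrite (_ : (fun z => _) = fun z => g i z + \sum_(j <- s) g j z).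
  exact: gauss_integrableD.
by apply/funext => z; rewrite big_cons.
Qed.

Lemma gauss_mean_sum (I : Type) (s : seq I) (g : I -> R -> R) :
  (forall i, gauss_integrable (g i)) ->
  gauss_mean (fun z => \sum_(i <- s) g i z) = \sum_(i <- s) gauss_mean (g i).
Proof.
move=> gi; elim: s => [|i s IH].
  rewrite big_nil -[RHS]gauss_mean_cst; congr gauss_mean.
  by apply/funext => z; rewrite big_nil.
rewrite big_cons -IH -gauss_meanD//; last exact: gauss_integrable_sum.
by congr gauss_mean; apply/funext => z; rewrite big_cons.
Qed.

Lemma phiE z : phi z = normal_peak 1 * expR (- (z ^+ 2 / 2)).
Proof. by rewrite normal_pdfE ?oner_neq0// /normal_fun subr0 expr1n mulNr. Qed.

(** Completing the square: exponential tilting moves the mean to [t], so the moment generating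
    function reduces to the total mass of a shifted Gaussian. *)
Lemma gauss_shift t z :
  expR (t * z) * phi z = expR (t ^+ 2 / 2) * normal_pdf t 1 z.
Proof.
rewrite phiE normal_pdfE ?oner_neq0// /normal_fun mulrCA [RHS]mulrCA.
congr (_ * _); rewrite -!expRD; by congr expR; rewrite expr1n; field.
Qed.

Lemma gauss_integrable_expR t : gauss_integrable (fun z => expR (t * z)).
Proof.
apply: eq_integrable (integrableZl _ (expR (t ^+ 2 / 2)) (integrable_normal_pdf t 1)) => //.
by move=> z _ /=; rewrite gauss_shift EFinM.
Qed.

Lemma gauss_mean_expR t : gauss_mean (fun z => expR (t * z)) = expR (t ^+ 2 / 2).
Proof.
rewrite /gauss_mean; under eq_Rintegral do rewrite gauss_shift.
rewrite RintegralZl//; last exact: integrable_normal_pdf.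
by rewrite /Rintegral integral_normal_pdf mulr1.
Qed.

Lemma gauss_integrable_norm3 : gauss_integrable (fun z => `|z| ^+ 3).
Proof.
(* The 6 is 3!, from |z|^3 / 3! <= exp |z|. *)
apply: (@gauss_integrable_le _ (fun z => 6 * (expR (1 * z) + expR (-1 * z)))).
- by apply: measurable_funX; exact: normr_measurable.
- move=> z; rewrite normrX normr_id.
  have := expR_ge1Dxn 2 (normr_ge0 z); rewrite /factorial/= => h.
  have h2 : expR `|z| <= expR (1 * z) + expR (-1 * z).
    by rewrite mul1r mulN1r; case: (ger0P z) => _; rewrite ?lerDl ?lerDr expR_ge0.
  by move: h h2; lra.
- by apply: gauss_integrableZ; apply: gauss_integrableD; exact: gauss_integrable_expR.
Qed.

Lemma gauss_integrable_norm : gauss_integrable (fun z => `|z|).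
Proof.
apply: (@gauss_integrable_le _ (fun z => 1 + `|z| ^+ 3)).
- exact: normr_measurable.
- move=> z; rewrite normr_id; have := normr_ge0 z; move: `|z| => u u0.
  have u3 : 0 <= u ^+ 3 by exact: exprn_ge0.
  have u2 : 0 <= u ^+ 2 by exact: exprn_ge0.
  by have [u1|u1] := lerP u 1; nra.
- apply: gauss_integrableD; first exact: gauss_integrable_cst.
  exact: gauss_integrable_norm3.
Qed.

Lemma gauss_integrable_id : gauss_integrable id.
Proof. by apply: gauss_integrable_le gauss_integrable_norm. Qed.

Lemma gauss_integrable_sqr : gauss_integrable (fun z => z ^+ 2).
Proof.
apply: (@gauss_integrable_le _ (fun z => 1 + `|z| ^+ 3)).
- exact: measurable_funX.
- move=> z; rewrite normrX; have := normr_ge0 z; move: `|z| => u u0.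
  have u3 : 0 <= u ^+ 3 by exact: exprn_ge0.
  have u2 : 0 <= u ^+ 2 by exact: exprn_ge0.
  by have [u1|u1] := lerP u 1; nra.
- apply: gauss_integrableD; first exact: gauss_integrable_cst.
  exact: gauss_integrable_norm3.
Qed.

(** From t z <= exp (t z) - 1 follows t m <= exp (t^2 / 2) - 1, which is O(t^2); small [t] of both
    signs force m = 0. *)
Lemma gauss_mean_id : gauss_mean id = 0.
Proof.
set m := gauss_mean id.
have key t : t * m <= expR (t ^+ 2 / 2) - 1.
  have <- : gauss_mean (fun z => t * z) = t * m.
    by rewrite -gauss_meanZ//; exact: gauss_integrable_id.
  rewrite -gauss_mean_expR -[X in _ - X]gauss_mean_cst -gauss_meanB; last 2 first.
  - exact: gauss_integrable_expR.
  - exact: gauss_integrable_cst.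
  apply: gauss_mean_le.
  - exact/gauss_integrableZ/gauss_integrable_id.
  - apply: (@eq_gauss_integrable (fun z => expR (t * z) + (-1))) => //.
    by apply: gauss_integrableD; [exact: gauss_integrable_expR|exact: gauss_integrable_cst].
  - by move=> z; have := expR_ge1Dx (t * z); lra.
have quad t : -1 <= t <= 1 -> t * m <= t ^+ 2.
  move=> t1; apply: (le_trans (key t)).
  have := expR_ge1Dx (- (t ^+ 2 / 2)).
  have := expRxMexpNx_1 (t ^+ 2 / 2); have := expR_gt0 (t ^+ 2 / 2).
  move: (expR (t ^+ 2 / 2)) (expR (- (t ^+ 2 / 2))) => a b a0 ab b1.
  have : t ^+ 2 <= 1 by nra.
  move: (t ^+ 2) (sqr_ge0 t) b1 => s s0 b1 s1.
  have h : a * (1 - s / 2) <= a * b. by rewrite (ler_wpM2l (ltW a0)).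
  rewrite ab in h.
  have : a <= 2 by nra.
  nra.
apply/eqP; rewrite eq_le; apply/andP; split; apply/ler_addgt0Pr => e e0.
- pose t := Order.min e 1.
  have t0 : 0 < t by rewrite lt_min e0 ltr01.
  have t1 : t <= 1 by rewrite ge_min lexx orbT.
  have te : t <= e by rewrite ge_min lexx.
  have /quad : -1 <= t <= 1 by apply/andP; split; lra.
  rewrite expr2 ler_pM2l//; lra.
- pose t := Order.min e 1.
  have t0 : 0 < t by rewrite lt_min e0 ltr01.
  have t1 : t <= 1 by rewrite ge_min lexx orbT.
  have te : t <= e by rewrite ge_min lexx.
  have /quad : -1 <= - t <= 1 by apply/andP; split; lra.
  rewrite sqrrN mulNr -mulrN expr2 ler_pM2l//; lra.
Qed.

(* Rescaling the density turns [gauss_mean] of [exp (- a z^2)] into the total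
   mass of a Gaussian of another variance; [exp u >= 1 + u] then pins down the
   second moment without any integration by parts. *)
Lemma gauss_mean_sqr : gauss_mean (fun z => z ^+ 2) = 1.
Proof.
set m := gauss_mean _.
have key s : 0 < s -> 1 - (s ^- 2 - 1) * (m / 2) <= s.
  move=> s0.
  have E z : expR (- ((s ^- 2 - 1) * (z ^+ 2 / 2))) * phi z = s * normal_pdf 0 s z.
    rewrite phiE normal_pdfE ?gt_eqF// /normal_fun subr0 mulrCA -expRD [RHS]mulrA.
    congr (_ * _).
      rewrite /normal_peak expr1n mul1r -mulrnAr sqrtrM ?sqr_ge0// invfM mulrA.
      by rewrite sqrtr_sqr gtr0_norm// mulfV ?mul1r// gt_eqF.
    congr expR; field; by rewrite gt_eqF.
  have G : gauss_mean (fun z => expR (- ((s ^- 2 - 1) * (z ^+ 2 / 2)))) = s.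
    rewrite /gauss_mean; under eq_Rintegral do rewrite E.
    rewrite RintegralZl//; last exact: integrable_normal_pdf.
    by rewrite /Rintegral integral_normal_pdf mulr1.
  rewrite -[leRHS]G.
  have -> : (s ^- 2 - 1) * (m / 2) =
            gauss_mean (fun z => ((s ^- 2 - 1) / 2) * z ^+ 2).
    rewrite gauss_meanZ; last exact: gauss_integrable_sqr.
    by rewrite -/m; ring.
  have i2 := gauss_integrableZ ((s ^- 2 - 1) / 2) gauss_integrable_sqr.
  rewrite -[X in X - _](gauss_mean_cst 1) -gauss_meanB//; last first.
    exact: gauss_integrable_cst.
  apply: gauss_mean_le.
  - apply: (@eq_gauss_integrable (fun z => 1 + - 1 * (((s ^- 2 - 1) / 2) * z ^+ 2))).
      by move=> z; rewrite mulN1r.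
    by apply: gauss_integrableD; [exact: gauss_integrable_cst|exact: gauss_integrableZ].
  - apply: eq_integrable (integrableZl _ s (integrable_normal_pdf 0 s)) => //.
    by move=> z _ /=; rewrite E.
  - by move=> z; have := expR_ge1Dx (- ((s ^- 2 - 1) * (z ^+ 2 / 2))); lra.
(* Clearing denominators leaves a factor 1 - s on both sides. Its sign turns the inequality into a
   lower bound on [m] for s < 1 and an upper bound for s > 1; both bounds tend to 1 as s does. *)
have key2 s : 0 < s -> 2 * s ^+ 2 * (1 - s) <= (1 - s) * (1 + s) * m.
  move=> s0; have p : 0 < 2 * s ^+ 2 by rewrite mulr_gt0// exprn_gt0.
  have h : (1 - (s ^- 2 - 1) * (m / 2)) * (2 * s ^+ 2) <= s * (2 * s ^+ 2).
    by rewrite ler_pM2r// key.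
  have E : (1 - (s ^- 2 - 1) * (m / 2)) * (2 * s ^+ 2) =
     2 * s ^+ 2 - (1 - s ^+ 2) * m by field; rewrite gt_eqF.
  by rewrite E in h; nra.
have lo s : 0 < s < 1 -> 2 * s ^+ 2 <= (1 + s) * m.
  move=> /andP[s0 s1]; have := key2 s s0; rewrite mulrC -mulrA ler_pM2l//; lra.
have hi s : 1 < s -> (1 + s) * m <= 2 * s ^+ 2.
  move=> s1; have := key2 s (lt_trans ltr01 s1).
  rewrite mulrC -mulrA ler_nM2l//; lra.
have m0 : 0 <= m.
  have := lo (1/2); rewrite divr_gt0//= ltr_pdivrMr// => /(_ ltac:(lra)); lra.
apply/eqP; rewrite eq_le; apply/andP; split; apply/ler_addgt0Pr => e e0.
- have := hi (1 + Order.min (e / 4) 1).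
  have : 0 < Order.min (e / 4) 1 by rewrite lt_min ltr01 divr_gt0.
  have : Order.min (e / 4) 1 <= e / 4 by rewrite ge_min lexx.
  have : Order.min (e / 4) 1 <= 1 by rewrite ge_min lexx orbT.
  move: (Order.min _ _) => d d1 de d0 /(_ ltac:(lra)) => H.
  nra.
- have := lo (1 - Order.min (e / 4) (1/2)).
  have : 0 < Order.min (e / 4) (1/2 : R) by rewrite lt_min !divr_gt0.
  have : Order.min (e / 4) (1/2) <= e / 4 by rewrite ge_min lexx.
  have : Order.min (e / 4) (1/2 : R) <= (1/2) by rewrite ge_min lexx orbT.
  move: (Order.min _ _) => d d1 de d0 /(_ ltac:(lra)) => H.
  nra.
Qed.

End gaussian_expectation.

(** * Convolution of Gaussians *)

Section gaussian_convolution.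
Context {R : realType}.
Implicit Types (f g : R -> R) (x y z t : R).
Notation mu := (@lebesgue_measure R).
Notation phi := (normal_pdf (0 : R) 1).

Lemma gauss_meanE g : gauss_integrable g ->
  (gauss_mean g)%:E = (\int[mu]_z (g z * phi z)%:E)%E.
Proof.
by move=> ig; rewrite /gauss_mean /Rintegral fineK//; exact: integrable_fin_num ig.
Qed.

Lemma normal_peakE (s : R) : 0 < s -> normal_peak s = s^-1 * normal_peak 1.
Proof.
move=> s0; rewrite /normal_peak expr1n mul1r -mulrnAr sqrtrM ?sqr_ge0// invfM.
by rewrite sqrtr_sqr gtr0_norm.
Qed.

Lemma normal_pdf_affine x (s : R) z : 0 < s ->
  normal_pdf x s (x + s * z) * s = phi z.
Proof.
move=> s0; rewrite phiE normal_pdfE ?gt_eqF// /normal_fun normal_peakE//.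
set E := expR _; have -> : s^-1 * normal_peak 1 * E * s = (s^-1 * s) * (normal_peak 1 * E) by ring.
rewrite mulVf ?gt_eqF// mul1r; congr (_ * expR _).
by field; rewrite gt_eqF.
Qed.

Lemma integral_affine_normal f x (s : R) : 0 < s -> continuous f -> (forall y, 0 <= f y) ->
  (\int[mu]_z (f (x + s * z) * phi z)%:E = \int[mu]_y (f y * normal_pdf x s y)%:E)%E.
Proof.
move=> s0 cf f0; pose F : R -> R := fun z => x + s * z.
have dF z : is_derive z 1 F s.
  rewrite /F; apply: is_derive_eq; rewrite ?add0r ?scaler1 //.
  exact: mul1r.
have F'E : F^`()%classic = cst s.
  by apply/funext => z; rewrite derive1E; exact: derive_val.
rewrite (increasing_ge0_integration_by_substitutionT (F := F)
  (G := fun y => f y * normal_pdf x s y)).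
- apply: eq_integral => z _; rewrite F'E !fctE/= /F.
  congr EFin; by rewrite -(normal_pdf_affine x z s0) mulrA.
- by move=> y z yz; rewrite /F ltrD2l ltr_pM2l.
- by rewrite F'E => ?; exact: cvg_cst.
- by rewrite F'E; exact: is_cvg_cst.
- by rewrite F'E; exact: is_cvg_cst.
- by move=> z; exact: ex_derive.
- rewrite /F; apply: cvg_comp (cvg_addrl_Ny x).
  by apply/gt0_cvgMrNy.
- rewrite /F; apply: cvg_comp (cvg_addrl x).
  by apply/gt0_cvgMry.
- move=> y; apply: cvgM; first exact: cf.
  by apply: continuous_normal_pdf; rewrite gt_eqF.
- by move=> y; rewrite mulr_ge0// normal_pdf_ge0.
Qed.

(** Both sides are the joint density of Y = x + b W + a Z and W. On the right, Y has mean [x] and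
    deviation [c], and given Y = y the variable W has mean b (y - x) / c^2 and deviation a / c. *)
Lemma normal_pdf_convolution x (a b c : R) y w : 0 < a -> 0 < c ->
  c ^+ 2 = a ^+ 2 + b ^+ 2 ->
  normal_pdf (x + b * w) a y * phi w =
  normal_pdf x c y * normal_pdf (b * (y - x) / c ^+ 2) (a / c) w.
Proof.
move=> a0 c0 cE.
have ac0 : 0 < a / c by rewrite divr_gt0.
rewrite phiE !normal_pdfE ?gt_eqF// /normal_fun.
rewrite (normal_peakE a0) (normal_peakE c0) (normal_peakE ac0).
set e1 := expR _; set e2 := expR _; set e3 := expR _; set e4 := expR _.
have -> : a^-1 * normal_peak 1 * e1 * (normal_peak 1 * e2) =
          a^-1 * (normal_peak 1 * normal_peak 1) * (e1 * e2) by ring.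
have -> : c^-1 * normal_peak 1 * e3 * ((a / c)^-1 * normal_peak 1 * e4) =
          (c^-1 * (a / c)^-1) * (normal_peak 1 * normal_peak 1) * (e3 * e4) by ring.
congr (_ * _ * _); first by field; rewrite !gt_eqF.
rewrite /e1 /e2 /e3 /e4 -!expRD; congr expR.
have c2 : c ^+ 2 != 0 by rewrite gt_eqF ?exprn_gt0.
rewrite [(a / c) ^+ 2]expr_div_n !mulNr -!opprD; congr (- _).
rewrite cE in c2 *; field.
by rewrite c2 gt_eqF.
Qed.


Section unit_valued.
Variable f : R -> R.
Hypothesis cf : continuous f.
Hypothesis f01 : forall y, 0 <= f y <= 1.

Let f0 y : 0 <= f y. Proof. by case/andP: (f01 y). Qed.

Let mf : measurable_fun setT f. Proof. exact: continuous_measurable_fun. Qed.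

Lemma measurable_affine_comp x (a : R) : measurable_fun setT (fun z => f (x + a * z)).
Proof.
by apply: measurableT_comp mf _; apply: measurable_funD.
Qed.

Lemma gauss_integrable_affine x (a : R) : gauss_integrable (fun z => f (x + a * z)).
Proof.
apply: (@gauss_integrable_bounded _ _ 1); first exact: measurable_affine_comp.
by move=> z; rewrite ger0_norm//; case/andP: (f01 (x + a * z)).
Qed.

Lemma gauss_mean_affine01 x (a : R) :
  0 <= gauss_mean (fun z => f (x + a * z)) <= 1.
Proof.
apply/andP; split.
  rewrite -[leLHS]gauss_mean_cst; apply: gauss_mean_le => //.
  - exact: gauss_integrable_cst.
  - exact: gauss_integrable_affine.
rewrite -[leRHS]gauss_mean_cst; apply: gauss_mean_le => //.
- exact: gauss_integrable_affine.
- exact: gauss_integrable_cst.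
- by move=> z; case/andP: (f01 (x + a * z)).
Qed.

Lemma measurable_gauss_mean_affine x (a b : R) :
  measurable_fun setT (fun w => gauss_mean (fun z => f (x + b * w + a * z))).
Proof.
pose F (u : measurableTypeR R * measurableTypeR R) : \bar R :=
  (f (x + b * u.1 + a * u.2) * phi u.2)%:E.
have mF : measurable_fun setT F.
  apply/measurable_EFinP/measurable_funM.
    apply: measurableT_comp mf _; apply: measurable_funD.
      by apply: measurable_funD => //; apply: measurable_funM.
    by apply: measurable_funM.
  by apply: measurableT_comp; [exact: measurable_normal_pdf|exact: measurable_snd].
have F0 u : (0 <= F u)%E by rewrite lee_fin mulr_ge0// phi_ge0.
have := measurable_fun_fubini_tonelli_F (m2 := mu) F mF F0.
by move=> /(measurableT_comp (@fine_measurable R setT measurableT)).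
Qed.

Lemma gauss_integrable_mean_affine x (a b : R) :
  gauss_integrable (fun w => gauss_mean (fun z => f (x + b * w + a * z))).
Proof.
apply: (@gauss_integrable_bounded _ _ 1); first exact: measurable_gauss_mean_affine.
by move=> w; have /andP[? ?] := gauss_mean_affine01 (x + b * w) a; rewrite ger0_norm.
Qed.

(** After a change of variable and Tonelli, the inner integral is the total mass of the conditional
    density of [normal_pdf_convolution]. *)
Lemma gauss_mean_semigroup x (a b c : R) : 0 <= a -> 0 <= c ->
  c ^+ 2 = a ^+ 2 + b ^+ 2 -> 0 <= b ->
  gauss_mean (fun w => gauss_mean (fun z => f (x + b * w + a * z))) =
  gauss_mean (fun z => f (x + c * z)).
Proof.
move=> a0 c0 cE b0.
(* Deviation zero has no density, but then the inner mean is that of a constant. *)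
have [a_eq0|a_neq0] := eqVneq a 0.
  have -> : c = b.
    by apply/eqP; rewrite -(@eqrXn2 _ 2%N)// cE a_eq0 expr0n add0r.
  congr gauss_mean; apply/funext => w; rewrite -[RHS]gauss_mean_cst.
  by congr gauss_mean; apply/funext => z; rewrite a_eq0 mul0r addr0.
have a_gt0 : 0 < a by rewrite lt_neqAle eq_sym a_neq0.
have c_gt0 : 0 < c.
  rewrite lt_neqAle c0 andbT eq_sym; apply/eqP => c_eq0.
  move: cE; rewrite c_eq0 expr0n/= => /esym/eqP.
  by rewrite paddr_eq0 ?sqr_ge0// sqrf_eq0 (negbTE a_neq0).
apply: EFin_inj; rewrite !gauss_meanE; last 2 first.
- exact: gauss_integrable_affine.
- exact: gauss_integrable_mean_affine.
pose F (u : measurableTypeR R * measurableTypeR R) : \bar R :=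
  (f u.2 * normal_pdf x c u.2 *
   normal_pdf (b * (u.2 - x) / c ^+ 2) (a / c) u.1)%:E.
transitivity (\int[mu]_w \int[mu]_y F (w, y))%E.
  apply: eq_integral => w _.
  rewrite EFinM gauss_meanE; last exact: gauss_integrable_affine.
  rewrite integral_affine_normal// muleC -ge0_integralZl//=.
  - apply: eq_integral => y _; rewrite /F/= -EFinM -mulrA.
    rewrite -(normal_pdf_convolution _ _ _ a_gt0 c_gt0 cE).
    by congr EFin; ring.
  - apply/measurable_EFinP/measurable_funM => //; exact: measurable_normal_pdf.
  - by move=> y _; rewrite lee_fin mulr_ge0// normal_pdf_ge0.
  - by rewrite lee_fin phi_ge0.
rewrite fubini_tonelli; last 2 first.
- apply/measurable_EFinP/measurable_funM.
    apply: measurable_funM; first exact: measurableT_comp.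
    by apply: measurableT_comp; [exact: measurable_normal_pdf|exact: measurable_snd].
  under eq_fun do rewrite normal_pdfE ?gt_eqF ?divr_gt0//.
  rewrite /normal_fun; apply: measurable_funM => //.
  apply: measurableT_comp => //; apply: measurable_funM => //.
  apply: measurableT_comp => //; apply: measurable_funX.
  apply: measurable_funB; first exact: measurable_fst.
  apply: measurable_funM => //; apply: measurable_funM => //.
  by apply: measurable_funB => //; exact: measurable_snd.
- by move=> u; rewrite lee_fin !mulr_ge0// normal_pdf_ge0.
rewrite integral_affine_normal//; apply: eq_integral => y _.
rewrite /F/=; under eq_integral do rewrite EFinM.
rewrite ge0_integralZl//=.
- by rewrite integral_normal_pdf mule1.
- by apply/measurable_EFinP; exact: measurable_normal_pdf.
- by move=> w _; rewrite lee_fin normal_pdf_ge0.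
- by rewrite lee_fin mulr_ge0// normal_pdf_ge0.
Qed.

End unit_valued.

End gaussian_convolution.

(** * Smooth test functions and the expansion of their Gaussian means *)

Section smooth_test_functions.
Context {R : realType}.
Implicit Types f : R -> R.

(* [df] and [ddf] play the roles of the first two derivatives of [f]. *)
Definition smooth_test f (df ddf : R -> R) (F1 F : R) := [/\ continuous f, forall y, 0 <= f y <= 1,
  forall y h, `|f (y + h) - f y| <= F1 * `|h| &
  forall y h, `|f (y + h) - f y - h * df y - h ^+ 2 / 2 * ddf y| <= F * `|h| ^+ 3].

Definition gauss_abs1 : R := gauss_mean (fun z => `|z|).
Definition gauss_abs3 : R := gauss_mean (fun z => `|z| ^+ 3).

Lemma gauss_abs1_ge0 : 0 <= gauss_abs1.
Proof.
rewrite -(gauss_mean_cst (0 : R)); apply: gauss_mean_le => //.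
- exact: gauss_integrable_cst.
- exact: gauss_integrable_norm.
Qed.

Lemma gauss_abs3_ge0 : 0 <= gauss_abs3.
Proof.
rewrite -(gauss_mean_cst (0 : R)); apply: gauss_mean_le => //.
- exact: gauss_integrable_cst.
- exact: gauss_integrable_norm3.
Qed.

Section one_test.
Variables (f df ddf : R -> R) (F1 F : R).
Hypothesis tf : smooth_test f df ddf F1 F.

Let cf : continuous f. Proof. by case: tf. Qed.
Let f01 y : 0 <= f y <= 1. Proof. by case: tf. Qed.
Let lipf y h : `|f (y + h) - f y| <= F1 * `|h|. Proof. by case: tf. Qed.
Let taylorf y h : `|f (y + h) - f y - h * df y - h ^+ 2 / 2 * ddf y| <= F * `|h| ^+ 3.
Proof. by case: tf. Qed.

Lemma smooth_test_F1_ge0 : 0 <= F1.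
Proof. by have := le_trans (normr_ge0 _) (lipf 0 1); rewrite normr1 mulr1. Qed.

Lemma smooth_test_F_ge0 : 0 <= F.
Proof.
by have := le_trans (normr_ge0 _) (taylorf 0 1); rewrite normr1 expr1n mulr1.
Qed.

Lemma cube_norm_add (a b : R) : `|a + b| ^+ 3 <= 4 * (`|a| ^+ 3 + `|b| ^+ 3).
Proof.
have := ler_normD a b; have := normr_ge0 (a + b).
have := normr_ge0 a; have := normr_ge0 b.
move: `|a| `|b| `|a + b| => u v w u0 v0 w0 wuv.
apply: (@le_trans _ _ ((u + v) ^+ 3)).
  by rewrite lerXn2r// ?nnegrE ?addr_ge0// addrC.
have h : 0 <= (u + v) * (u - v) ^+ 2 by rewrite mulr_ge0 ?addr_ge0 ?sqr_ge0.
have -> : (u + v) ^+ 3 = 4 * (v ^+ 3 + u ^+ 3) - 3 * ((u + v) * (u - v) ^+ 2) by ring.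
lra.
Qed.

Lemma gauss_mean_taylor y Y s :
  `|gauss_mean (fun z => f (y + Y + s * z)) -
    (f y + Y * df y + (Y ^+ 2 + s ^+ 2) / 2 * ddf y)|
  <= F * (4 * (`|Y| ^+ 3 + `|s| ^+ 3 * gauss_abs3)).
Proof.
have i1 := @gauss_integrable_id R; have i2 := @gauss_integrable_sqr R.
have i3 := @gauss_integrable_norm3 R.
(* [P] is the second order Taylor polynomial of [f] at [y] in the increment Y + s z, sorted by
   powers of z so that the first two Gaussian moments give its mean. *)
pose c0 := f y + Y * df y + Y ^+ 2 / 2 * ddf y.
pose c1 := s * df y + Y * s * ddf y.
pose c2 := s ^+ 2 / 2 * ddf y.
pose P z := c0 + (c1 * z + c2 * z ^+ 2).
have iZ1 : gauss_integrable (fun z => c1 * z) := gauss_integrableZ c1 i1.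
have iZ2 : gauss_integrable (fun z => c2 * z ^+ 2) := gauss_integrableZ c2 i2.
have i12 : gauss_integrable (fun z => c1 * z + c2 * z ^+ 2) := gauss_integrableD iZ1 iZ2.
have m1 : gauss_mean (fun z => c1 * z) = 0.
  by have := gauss_meanZ c1 i1; rewrite (gauss_mean_id (R := R)) mulr0.
have m2 : gauss_mean (fun z => c2 * z ^+ 2) = c2.
  by rewrite (gauss_meanZ c2 i2) gauss_mean_sqr mulr1.
have m12 : gauss_mean (fun z => c1 * z + c2 * z ^+ 2) = c2.
  by rewrite (gauss_meanD iZ1 iZ2) m1 m2 add0r.
have iP : gauss_integrable P.
  by apply: gauss_integrableD => //; exact: gauss_integrable_cst.
have mP : gauss_mean P = f y + Y * df y + (Y ^+ 2 + s ^+ 2) / 2 * ddf y.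
  rewrite /P gauss_meanD//; last exact: gauss_integrable_cst.
  rewrite gauss_mean_cst m12.
  by rewrite /c0 /c2; ring.
have iF := gauss_integrable_affine cf f01 (y + Y) s.
rewrite -mP -gauss_meanB//.
have -> : F * (4 * (`|Y| ^+ 3 + `|s| ^+ 3 * gauss_abs3)) =
    gauss_mean (fun z => F * (4 * `|Y| ^+ 3) + F * (4 * `|s| ^+ 3) * `|z| ^+ 3).
  rewrite gauss_meanD; [|exact: gauss_integrable_cst|exact: gauss_integrableZ].
  by rewrite gauss_mean_cst gauss_meanZ// -/gauss_abs3; ring.
apply: gauss_mean_norm_le.
- apply: measurable_funB; first exact: measurable_affine_comp.
  apply: measurable_funD => //; apply: measurable_funD; first exact: measurable_funM.
  by apply: measurable_funM => //; exact: measurable_funX.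
- by apply: gauss_integrableD; [exact: gauss_integrable_cst|exact: gauss_integrableZ].
move=> z; apply: (@le_trans _ _ (F * `|Y + s * z| ^+ 3)).
  have -> : f (y + Y + s * z) - P z = f (y + (Y + s * z)) - f y -
      (Y + s * z) * df y - (Y + s * z) ^+ 2 / 2 * ddf y.
    rewrite (_ : y + Y + s * z = y + (Y + s * z)); last by ring.
    by rewrite /P /c0 /c1 /c2; field.
  exact: taylorf.
have -> : F * (4 * `|Y| ^+ 3) + F * (4 * `|s| ^+ 3) * `|z| ^+ 3 =
    F * (4 * (`|Y| ^+ 3 + `|s * z| ^+ 3)) by rewrite normrM; ring.
by rewrite ler_wpM2l ?smooth_test_F_ge0// cube_norm_add.
Qed.

Lemma gauss_mean_lipschitz y Y s s' :
  `|gauss_mean (fun z => f (y + Y + s * z)) - gauss_mean (fun z => f (y + s' * z))|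
  <= F1 * (`|Y| + `|s - s'| * gauss_abs1).
Proof.
have i1 := @gauss_integrable_norm R.
rewrite -gauss_meanB; [|exact: gauss_integrable_affine..].
have -> : F1 * (`|Y| + `|s - s'| * gauss_abs1) =
    gauss_mean (fun z => F1 * `|Y| + F1 * `|s - s'| * `|z|).
  rewrite gauss_meanD; [|exact: gauss_integrable_cst|exact: gauss_integrableZ].
  by rewrite gauss_mean_cst gauss_meanZ// -/gauss_abs1; ring.
apply: gauss_mean_norm_le.
- by apply: measurable_funB; exact: measurable_affine_comp.
- by apply: gauss_integrableD; [exact: gauss_integrable_cst|exact: gauss_integrableZ].
move=> z; have -> : y + Y + s * z = y + s' * z + (Y + (s - s') * z) by ring.
rewrite (le_trans (lipf _ _))// -mulrA -mulrDr ler_wpM2l ?smooth_test_F1_ge0//.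
by rewrite (le_trans (ler_normD _ _))// normrM.
Qed.

Lemma lipschitz_vs_gauss_mean y Y s :
  `|f (y + Y) - gauss_mean (fun z => f (y + s * z))|
  <= F1 * (`|Y| + `|s| * gauss_abs1).
Proof.
have := gauss_mean_lipschitz y Y 0 s; rewrite sub0r normrN.
rewrite (_ : (fun z => f (y + Y + 0 * z)) = fun=> f (y + Y)) ?gauss_mean_cst//.
by apply/funext => z; rewrite mul0r addr0.
Qed.

End one_test.

(** Serves to compare Gaussian deviations: the bound depends only on the difference of the
    variances, also near 0, where the square root is not Lipschitz. *)
Lemma sqrt_dist (a b : R) : 0 <= b -> b <= a ->
  `|Num.sqrt b - Num.sqrt a| <= Num.sqrt (a - b).
Proof.
move=> b0 ba; rewrite distrC ger0_norm ?subr_ge0 ?ler_wsqrtr//.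
rewrite lerBlDr -(@ler_pXn2r _ 2%N) ?nnegrE ?addr_ge0 ?sqrtr_ge0//.
rewrite sqr_sqrtr ?(le_trans b0)// sqrrD !sqr_sqrtr ?subr_ge0//.
have : 0 <= Num.sqrt (a - b) * Num.sqrt b *+ 2 by rewrite mulrn_wge0// mulr_ge0 ?sqrtr_ge0.
by lra.
Qed.

End smooth_test_functions.

(** * The logistic function as a smooth test function *)

Section logistic.
Context {R : realType}.
Implicit Types (y t x : R).

(** The mean value theorem raises the order of a bound by one. Three applications, starting from a
    bounded third derivative, give a cubic Taylor remainder with constant 1 in place of 1/6. *)
Lemma derive_growth (g dg : R -> R) (M : R) k h : 0 <= M -> g 0 = 0 ->
  (forall t, is_derive t 1 g (dg t)) ->
  (forall t, `|t| <= `|h| -> `|dg t| <= M * `|t| ^+ k) ->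
  `|g h| <= M * `|h| ^+ k.+1.
Proof.
move=> M0 g0 dgE dgM.
have cg : continuous g.
  by move=> t; apply/differentiable_continuous/derivable1_diffP; exact: ex_derive.
have [c ch gE] : exists2 c, `|c| <= `|h| & g h = dg c * h.
  have [h0|h0] := leP 0 h.
    have [c ch] := MVT_segment h0 (fun x _ => dgE x) (continuous_subspaceT cg).
    rewrite g0 !subr0 => gE; exists c => //.
    by move: ch; rewrite in_itv/= => /andP[c0 ch]; rewrite !ger0_norm.
  have [c ch] := MVT_segment (ltW h0) (fun x _ => dgE x) (continuous_subspaceT cg).
  rewrite g0 !sub0r => gE; exists c; last by rewrite -[LHS]opprK gE mulrN opprK.
  move: ch; rewrite in_itv/= => /andP[c0 ch].
  by rewrite !ler0_norm ?(ltW h0)// lerN2.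
rewrite gE normrM exprSr mulrA ler_wpM2r// (le_trans (dgM c ch))// ler_wpM2l//.
by rewrite lerXn2r ?nnegrE.
Qed.

(** The mirror image of the usual logistic function, decreasing so as to approximate indicators of
    lower half-lines. Its derivatives are polynomials in the function itself and therefore
    bounded. *)
Definition logistic y : R := (1 + expR y)^-1.
Definition logistic1 y : R := - (logistic y * (1 - logistic y)).
Definition logistic2 y : R := logistic y * (1 - logistic y) * (1 - 2 * logistic y).
Definition logistic3 y : R :=
  - (logistic y * (1 - logistic y) * (1 - 6 * logistic y + 6 * logistic y ^+ 2)).

Lemma logistic_den_gt0 y : 0 < 1 + expR y.
Proof. by rewrite addr_gt0// expR_gt0. Qed.

Lemma logistic_gt0 y : 0 < logistic y.
Proof. by rewrite invr_gt0 logistic_den_gt0. Qed.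

Lemma logistic_lt1 y : logistic y < 1.
Proof. by rewrite invf_lt1 ?logistic_den_gt0// ltrDl expR_gt0. Qed.

Lemma logisticN y : logistic (- y) = 1 - logistic y.
Proof.
rewrite /logistic expRN; have e0 := expR_gt0 y; have := logistic_den_gt0 y.
move: (expR y) e0 => u u0 u1; field.
by rewrite !gt_eqF//= addrC.
Qed.

Lemma logistic_decreasing x y : x <= y -> logistic y <= logistic x.
Proof. by move=> xy; rewrite lef_pV2 ?posrE ?logistic_den_gt0// lerD2l ler_expR. Qed.

Lemma logistic_small y : 0 < y -> logistic y <= y^-1.
Proof.
move=> y0; rewrite lef_pV2 ?posrE ?logistic_den_gt0//.
by have := expR_ge1Dx y; lra.
Qed.

Lemma is_derive_logistic y : is_derive y 1 logistic (logistic1 y).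
Proof.
have d1 : is_derive y 1 (fun t => 1 + expR t) (expR y).
  by apply: is_derive_eq; rewrite add0r mul1r.
have n0 : 1 + expR y != 0 by rewrite gt_eqF// logistic_den_gt0.
have -> : logistic1 y = - (1 + expR y) ^- 2 *: expR y; last exact: is_deriveV.
rewrite /logistic1 /logistic /GRing.scale/=.
by move: (expR y) n0 => u n0; field.
Qed.

Lemma is_derive_logistic1 y : is_derive y 1 logistic1 (logistic2 y).
Proof.
have d := is_derive_logistic y.
rewrite /logistic1; apply: is_derive_eq.
by rewrite /GRing.scale/= /logistic2 /logistic1; ring.
Qed.

Lemma is_derive_logistic2 y : is_derive y 1 logistic2 (logistic3 y).
Proof.
have d := is_derive_logistic y.
rewrite /logistic2; apply: is_derive_eq.
by rewrite /GRing.scale/= /logistic3 /logistic1; ring.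
Qed.

Lemma logistic3_bound y : `|logistic3 y| <= 1.
Proof.
rewrite /logistic3; have := logistic_gt0 y; have := logistic_lt1 y.
move: (logistic y) => u u1 u0; rewrite normrN.
have h1 : 0 <= u * (1 - u) by nra.
have h2 : u * (1 - u) <= 1 / 4 by have := sqr_ge0 (1 - 2 * u); nra.
by rewrite ler_norml; apply/andP; split; nra.
Qed.

Lemma logistic1_bound y : `|logistic1 y| <= 1.
Proof.
rewrite /logistic1; have := logistic_gt0 y; have := logistic_lt1 y.
move: (logistic y) => u u1 u0; rewrite normrN.
by rewrite ler_norml; apply/andP; split; nra.
Qed.

Lemma is_derive_shift (f : R -> R) (d : R) y t : is_derive (y + t) 1 f d ->
  is_derive t 1 (fun u => f (y + u)) d.
Proof.
move=> df; have d1 : is_derive t 1 (fun u => y + u) 1.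
  by apply: is_derive_eq; rewrite add0r mul1r.
by have := is_derive1_comp df d1; rewrite mulr1.
Qed.

Lemma smooth_test_logistic : smooth_test logistic logistic1 logistic2 1 1.
Proof.
split.
- move=> y; apply/differentiable_continuous/derivable1_diffP.
  by have d := is_derive_logistic y; exact: ex_derive.
- by move=> y; rewrite !ltW ?logistic_gt0 ?logistic_lt1.
- move=> y h; have := @derive_growth (fun t => logistic (y + t) - logistic y)
    (fun t => logistic1 (y + t)) 1 0 h ler01.
  rewrite addr0 subrr !expr1; apply=> // t; last first.
    by move=> _; rewrite expr0 mulr1 logistic1_bound.
  have d := is_derive_shift (is_derive_logistic (y + t)).
  by apply: is_derive_eq; rewrite subr0.
move=> y h.
have g2 t : `|logistic2 (y + t) - logistic2 y| <= 1 * `|t| ^+ 1.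
  apply: (@derive_growth (fun t => logistic2 (y + t) - logistic2 y)
    (fun t => logistic3 (y + t)) 1 0 t ler01).
  - by rewrite addr0 subrr.
  - move=> u; have d := is_derive_shift (is_derive_logistic2 (y + u)).
    by apply: is_derive_eq; rewrite subr0.
  - by move=> u _; rewrite expr0 mulr1 logistic3_bound.
have g1 t : `|logistic1 (y + t) - logistic1 y - t * logistic2 y| <= 1 * `|t| ^+ 2.
  apply: (@derive_growth (fun t => logistic1 (y + t) - logistic1 y - t * logistic2 y)
    (fun t => logistic2 (y + t) - logistic2 y) 1 1 t ler01).
  - by rewrite addr0 subrr mul0r subrr.
  - move=> u; have d := is_derive_shift (is_derive_logistic1 (y + u)).
    by apply: is_derive_eq; rewrite /GRing.scale/=; ring.
  - by move=> u _; exact: g2.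
apply: (@derive_growth
  (fun t => logistic (y + t) - logistic y - t * logistic1 y - t ^+ 2 / 2 * logistic2 y)
  (fun t => logistic1 (y + t) - logistic1 y - t * logistic2 y) 1 2 h ler01).
- by rewrite addr0 subrr; ring.
- move=> u; have d := is_derive_shift (is_derive_logistic (y + u)).
  by apply: is_derive_eq; rewrite /GRing.scale/=; field.
- by move=> u _; exact: g1.
Qed.

(** Each constant scales with the order of its estimate. For [k] of order m^(-1/2) this makes F1 + m
    F of order m^(-1/2). *)
Lemma smooth_test_affine (f f1 f2 : R -> R) (F1 F k b : R) : 0 <= k ->
  smooth_test f f1 f2 F1 F ->
  smooth_test (fun y => f (k * y + b)) (fun y => k * f1 (k * y + b))
    (fun y => k ^+ 2 * f2 (k * y + b)) (F1 * k) (F * k ^+ 3).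
Proof.
move=> k0 [cf f01 lipf tayf]; split.
- move=> y; apply: (@continuous_comp _ _ _ (fun y => k * y + b) f); last exact: cf.
  by apply: cvgD; [apply: cvgM; [exact: cvg_cst|exact: cvg_id]|exact: cvg_cst].
- by move=> y; exact: f01.
- move=> y h; have := lipf (k * y + b) (k * h).
  rewrite normrM (ger0_norm k0) mulrA.
  by rewrite (_ : k * (y + h) + b = k * y + b + k * h)//; ring.
- move=> y h; have := tayf (k * y + b) (k * h).
  rewrite normrM (ger0_norm k0).
  rewrite (_ : k * (y + h) + b = k * y + b + k * h); last by ring.
  set A := f (_ + k * h); set B := f _; set C := f1 _; set E := f2 _.
  rewrite (_ : A - B - k * h * C - (k * h) ^+ 2 / 2 * E =
    A - B - h * (k * C) - h ^+ 2 / 2 * (k ^+ 2 * E)); last by field.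
  by move=> /le_trans; apply; rewrite exprMn mulrA.
Qed.

End logistic.

(** * The normal distribution function against logistic means *)

Section gaussian_cdf.
Context {R : realType}.
Implicit Types x y z d e : R.

Definition gauss_cdf x : R := fine (normal_prob (0 : R) 1 `]-oo, x]%classic).

Lemma gauss_cdfE x : (gauss_cdf x)%:E = normal_prob (0 : R) 1 `]-oo, x]%classic.
Proof. by rewrite /gauss_cdf fineK//; exact: fin_num_measure. Qed.

Lemma gauss_integrable_indic x : gauss_integrable (\1_(`]-oo, x]%classic) : R -> R).
Proof.
apply: (@gauss_integrable_bounded _ _ 1); first exact: measurable_indic.
by move=> z; rewrite indicE; case: (_ \in _); rewrite ?normr1 ?normr0.
Qed.

Lemma gauss_mean_indic x : gauss_mean (\1_(`]-oo, x]%classic) : R -> R) = gauss_cdf x.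
Proof.
apply: EFin_inj; rewrite gauss_cdfE gauss_meanE; last exact: gauss_integrable_indic.
rewrite /normal_prob [RHS]integral_mkcond; apply: eq_integral => z _.
by rewrite patchE indicE; case: (_ \in _); rewrite ?mul1r ?mul0r.
Qed.

Lemma gauss_integrable_logistic x e :
  gauss_integrable (fun z => logistic ((z - x) / e)).
Proof.
apply: (@gauss_integrable_bounded _ _ 1).
  have [cl _ _ _] := @smooth_test_logistic R.
  apply: measurableT_comp; first exact: continuous_measurable_fun cl.
  by apply: measurable_funM => //; exact: measurable_funB.
by move=> z; rewrite ger0_norm ltW ?logistic_gt0 ?logistic_lt1.
Qed.

(** Here [e] is the width of the transition and [d] the distance beyond which the tail is discarded,
    where it is at most e / d. *)
Lemma logistic_le_indic x d e z : 0 < d -> 0 < e ->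
  logistic ((z - x) / e) <= (z <= x + d)%R%:R + e / d.
Proof.
move=> d0 e0; have [zx|zx] := leP z (x + d).
  by rewrite (le_trans (ltW (logistic_lt1 _)))// lerDl divr_ge0// ltW.
rewrite add0r; apply: (@le_trans _ _ (logistic (d / e))).
  by rewrite logistic_decreasing// ler_pM2r ?invr_gt0//; lra.
by rewrite -[leRHS]invf_div logistic_small// divr_gt0.
Qed.

Lemma indic_le_logistic x d e z : 0 < d -> 0 < e ->
  (z <= x - d)%R%:R <= logistic ((z - x) / e) + e / d.
Proof.
move=> d0 e0; have [zx|zx] := leP z (x - d); last first.
  by rewrite addr_ge0 ?(ltW (logistic_gt0 _))// divr_ge0// ltW.
apply: (@le_trans _ _ (logistic (- (d / e)) + e / d)); last first.
  by rewrite lerD2r logistic_decreasing// -mulNr ler_pM2r ?invr_gt0//; lra.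
have : logistic (d / e) <= e / d by rewrite -[leRHS]invf_div logistic_small// divr_gt0.
by rewrite logisticN /=; lra.
Qed.

Lemma gauss_mean_logistic_le x d e : 0 < d -> 0 < e ->
  gauss_mean (fun z => logistic ((z - x) / e)) <= gauss_cdf (x + d) + e / d.
Proof.
move=> d0 e0; rewrite -gauss_mean_indic -[e / d]gauss_mean_cst -gauss_meanD; last 2 first.
- exact: gauss_integrable_indic.
- exact: gauss_integrable_cst.
apply: gauss_mean_le; first exact: gauss_integrable_logistic.
  by apply: gauss_integrableD; [exact: gauss_integrable_indic|exact: gauss_integrable_cst].
by move=> z; rewrite indicE mem_setE in_itv/= logistic_le_indic.
Qed.

Lemma gauss_mean_logistic_ge x d e : 0 < d -> 0 < e ->
  gauss_cdf (x - d) <= gauss_mean (fun z => logistic ((z - x) / e)) + e / d.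
Proof.
move=> d0 e0; rewrite -gauss_mean_indic -[e / d]gauss_mean_cst -gauss_meanD; last 2 first.
- exact: gauss_integrable_logistic.
- exact: gauss_integrable_cst.
apply: gauss_mean_le; first exact: gauss_integrable_indic.
  by apply: gauss_integrableD; [exact: gauss_integrable_logistic|exact: gauss_integrable_cst].
by move=> z; rewrite indicE mem_setE in_itv/= indic_le_logistic.
Qed.

End gaussian_cdf.

Section geometric_convergence_consequences.
Context {R : realType}.

Lemma geom_cvg_bounded (a : nat -> R) l : geom_cvg a l ->
  exists2 K, 0 <= K & forall m, `|a m| <= K.
Proof.
move=> [M [r [M0 r0 r1 h]]]; exists (`|l| + M) => [|m]; first exact: addr_ge0.
rewrite -[a m](subrK l) addrC (le_trans (ler_normD _ _))// lerD2l (le_trans (h m))//.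
by rewrite ler_piMr// exprn_ile1// ltW.
Qed.

Lemma geom_cvg_cvgn (a : nat -> R) l : geom_cvg a l -> a n @[n --> \oo] --> l.
Proof.
move=> [M [r [M0 r0 r1 h]]].
have h0 : (fun m => M * r ^+ m) @ \oo --> (0 : R).
  rewrite -[X in _ --> X](mulr0 M); apply: cvgM; first exact: cvg_cst.
  by apply: cvg_expr; rewrite ger0_norm// ltW.
apply/cvgrPdist_le => e e0; move/cvgrPdist_le/(_ e e0): h0.
apply: filterS => m; rewrite sub0r normrN => /(le_trans (ler_norm _)).
by rewrite distrC; apply: le_trans.
Qed.

End geometric_convergence_consequences.

(** [S] is the probability to be estimated, [Sp] and [Sm] averages of smooth functions above and
    below it, [Gp] and [Gm] their Gaussian means, [cp] and [cm] nearby values of the normal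
    distribution function, [k] the limit. Each comparison costs one [e]. *)
Lemma sandwich_le (R : realFieldType) (e S Sp Sm Gp Gm cp cm k : R) :
  S <= Sp + e -> Sp - Gp <= e -> Gp <= cp + e -> cp - k <= e ->
  Sm <= S + e -> - e <= Sm - Gm -> cm <= Gm + e -> - e <= cm - k ->
  `|S - k| <= 4 * e.
Proof. by move=> *; rewrite ler_norml; apply/andP; split; lra. Qed.

(** * The central limit theorem for block sums *)

(* The application has [h m = H m.+1] and [kap N] the number of summands of [N];
   [h_rec] strips the first block [b], of length [T b] and digit sum [D b], from a
   word of length [m], and [q ^+ T b] is the limiting probability of that block.
   The shell [h n <= N < h n.+1] is [Omega_(n+1)]. *)
Section block_sums.
Context {R : realType} (B : finType) (T D : B -> nat) (q : R) (b0 b1 : B) (L : nat).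
Context (h : nat -> nat) (kap : nat -> R).
Hypothesis L_gt1 : (1 < L)%N.
Hypothesis T_bounds : forall b, (1 <= T b <= L)%N.
Hypothesis T_b0 : T b0 = 1%N.
Hypothesis D_b0 : D b0 = 0%N.
Hypothesis D_b1 : (0 < D b1)%N.
Hypothesis q_gt0 : 0 < q.
Hypothesis q_lt1 : q < 1.
Hypothesis sum_q : \sum_b q ^+ T b = 1.
Hypothesis h_gt0 : forall m, (0 < h m)%N.
Hypothesis h_le : forall m, (h m <= h m.+1)%N.
Hypothesis h_rec : forall m (g : R -> R), (L <= m)%N ->
  \sum_(0 <= N < h m) g (kap N) =
  \sum_b \sum_(0 <= N < h (m - T b)) g ((D b)%:R + kap N).

Let p b := q ^+ T b.
Let p_gt0 b : 0 < p b. Proof. exact: exprn_gt0. Qed.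

Definition block_length_mean : R := \sum_b q ^+ T b * (T b)%:R.
Definition drift : R := (\sum_b q ^+ T b * (D b)%:R) / block_length_mean.
Definition block_fluct (b : B) : R := (D b)%:R - drift * (T b)%:R.
Definition diffusivity : R :=
  (\sum_b q ^+ T b * block_fluct b ^+ 2) / block_length_mean.

Local Notation mu := drift.
Local Notation Y := block_fluct.
Local Notation s2 := diffusivity.

Lemma block_length_mean_gt0 : 0 < block_length_mean.
Proof.
rewrite /block_length_mean (bigD1 b0)//= ltr_pwDl//.
  by rewrite T_b0 mulr1 expr1.
by apply: sumr_ge0 => b _; rewrite mulr_ge0// ltW// p_gt0.
Qed.

Lemma drift_gt0 : 0 < mu.
Proof.
rewrite divr_gt0 ?block_length_mean_gt0// (bigD1 b1)//= ltr_pwDl//.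
  by rewrite mulr_gt0 ?p_gt0// ltr0n.
by apply: sumr_ge0 => b _; rewrite mulr_ge0// ltW// p_gt0.
Qed.

(** The block [b0] has length 1 and digit sum 0, so its fluctuation is [- mu], which is nonzero. *)
Lemma diffusivity_gt0 : 0 < s2.
Proof.
rewrite divr_gt0 ?block_length_mean_gt0// (bigD1 b0)//= ltr_pwDl//.
  rewrite mulr_gt0 ?p_gt0// /Y T_b0 D_b0 sub0r mulr1 sqrrN.
  by rewrite exprn_gt0// drift_gt0.
by apply: sumr_ge0 => b _; rewrite mulr_ge0 ?sqr_ge0// ltW// p_gt0.
Qed.

Lemma block_fluct_centered : \sum_b q ^+ T b * Y b = 0.
Proof.
rewrite /Y; under eq_bigr do rewrite mulrBr mulrCA.
rewrite sumrB -mulr_sumr -/block_length_mean /mu divfK ?subrr//.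
by rewrite gt_eqF// block_length_mean_gt0.
Qed.

Lemma block_fluct_sqr :
  \sum_b q ^+ T b * Y b ^+ 2 = s2 * block_length_mean.
Proof. by rewrite /s2 divfK// gt_eqF// block_length_mean_gt0. Qed.

(** The weight q^m offsets the growth of [h m], so that the total mass converges. The argument [x]
    makes the recursion close: splitting off a block [b] moves its fluctuation [Y b] into it. *)
Definition wsum m (g : R -> R) (x : R) : R :=
  q ^+ m * \sum_(0 <= N < h m) g (x + kap N - mu * m%:R).

Lemma wsum_rec m g x : (L <= m)%N ->
  wsum m g x = \sum_b q ^+ T b * wsum (m - T b) g (x + Y b).
Proof.
move=> Lm; rewrite /wsum (h_rec (fun y => g (x + y - mu * m%:R)) Lm) mulr_sumr.
apply: eq_bigr => b _; have /andP[_ TL] := T_bounds b.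
have Tm : (T b <= m)%N := leq_trans TL Lm.
rewrite mulrA -exprD subnKC//; congr (_ * _); apply: eq_bigr => N _; congr g.
by rewrite /Y natrB//; ring.
Qed.

Definition mass m := wsum m (fun=> 1) 0.

Lemma massE m : mass m = q ^+ m * (h m)%:R.
Proof. by rewrite /mass /wsum sumr_const_nat subn0. Qed.

Lemma wsum_cst m k x : wsum m (fun=> k) x = k * mass m.
Proof. by rewrite /mass /wsum !sumr_const_nat subn0 -mulr_natr; ring. Qed.

Lemma mass_rec m : (L <= m)%N -> mass m = \sum_b q ^+ T b * mass (m - T b).
Proof.
move=> Lm; rewrite {1}/mass wsum_rec//; apply: eq_bigr => b _.
Qed.

(** Makes the limit in [mass_cvg] positive. The bound holds for m < L because h m >= 1, and
    averaging preserves it. *)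
Lemma mass_lower m : q ^+ L <= mass m.
Proof.
elim/ltn_ind: m => m IH; have [mL|Lm] := ltnP m L.
  rewrite massE; apply: (@le_trans _ _ (q ^+ m)).
    by rewrite (ler_wiXn2l (ltW q_gt0) (ltW q_lt1))// ltnW.
  by rewrite ler_peMr ?exprn_ge0 ?(ltW q_gt0)// ler1n.
rewrite mass_rec// -[leLHS]mul1r -sum_q mulr_suml; apply: ler_sum => b _.
rewrite ler_wpM2l ?(ltW (p_gt0 b))// IH//.
by have /andP[? ?] := T_bounds b; lia.
Qed.

Lemma mass_cvg : exists2 C, 0 < C & geom_cvg mass C.
Proof.
have [C aC] : exists C, geom_cvg mass C.
  apply: (renewal_geom_cvg L_gt1 T_bounds T_b0 q_gt0 q_lt1 sum_q (geom_cvg_cst 0)).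
  by move=> m Lm; rewrite addr0 mass_rec.
exists C => //; apply: (@lt_le_trans _ _ (q ^+ L)); first by rewrite exprn_gt0.
have /cvg_lim <- // := geom_cvg_cvgn aC.
apply: limr_ge; first by apply/cvg_ex; exists C; exact: geom_cvg_cvgn.
by near=> m; exact: mass_lower.
Unshelve. all: by end_near. Qed.

Definition first_moment m := wsum m id 0.
Definition second_moment m := wsum m (fun x => x ^+ 2) 0.

Lemma wsum_id m x : wsum m id x = first_moment m + x * mass m.
Proof.
rewrite /first_moment massE /wsum.
under eq_bigr do rewrite -addrA addrC.
rewrite big_split/= sumr_const_nat subn0.
under [X in _ = q ^+ m * X + _]eq_bigr do rewrite add0r.
by rewrite -mulr_natr; ring.
Qed.

Lemma wsum_sqr m x : wsum m (fun y => y ^+ 2) x =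
  second_moment m + 2 * x * first_moment m + x ^+ 2 * mass m.
Proof.
rewrite /second_moment /first_moment massE /wsum.
have E N : (x + kap N - mu * m%:R) ^+ 2 =
  (0 + kap N - mu * m%:R) ^+ 2 + 2 * x * (0 + kap N - mu * m%:R) + x ^+ 2 by ring.
under eq_bigr do rewrite E.
rewrite 2!big_split/= sumr_const_nat subn0 -mulr_sumr -[x ^+ 2 *+ _]mulr_natr.
by ring.
Qed.

(** The error term of the recursion tends to C times the mean of [Y], which vanishes by the choice
    of the drift. *)
Lemma first_moment_cvg : exists A, geom_cvg first_moment A.
Proof.
have [C _ aC] := mass_cvg.
apply: (renewal_geom_cvg (e := fun m => \sum_b q ^+ T b * (Y b * mass (m - T b)))
  L_gt1 T_bounds T_b0 q_gt0 q_lt1 sum_q).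
  have E0 : 0 = \sum_b q ^+ T b * (Y b * C).
    by under eq_bigr do rewrite mulrA; rewrite -mulr_suml block_fluct_centered mul0r.
  rewrite [X in geom_cvg _ X]E0.
  apply: (geom_cvg_sum _ (a := fun b m => q ^+ T b * (Y b * mass (m - T b)))
    (l := fun b => q ^+ T b * (Y b * C))) => b.
  by do 2 apply: geom_cvgZ; exact: geom_cvg_subn.
move=> m Lm; rewrite {1}/first_moment wsum_rec// -big_split/=.
by apply: eq_bigr => b _; rewrite wsum_id add0r mulrDr.
Qed.

(** With the linear growth subtracted, the error term tends to 2 A E Y + C (E Y^2 - s2 E T), with E
    the mean for the weights q^T. The choices of [mu] and [s2] make this zero. *)
Lemma second_moment_cvg :
  exists V, geom_cvg (fun m => second_moment m - s2 * m%:R * mass m) V.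
Proof.
have [C _ aC] := mass_cvg; have [A fA] := first_moment_cvg.
apply: (renewal_geom_cvg (e := fun m => \sum_b q ^+ T b *
   (2 * Y b * first_moment (m - T b) + (Y b ^+ 2 - s2 * (T b)%:R) * mass (m - T b)))
  L_gt1 T_bounds T_b0 q_gt0 q_lt1 sum_q).
  have E0 : 0 = \sum_b q ^+ T b * (2 * Y b * A + (Y b ^+ 2 - s2 * (T b)%:R) * C).
    transitivity (2 * A * (\sum_b q ^+ T b * Y b) + C * (\sum_b q ^+ T b * Y b ^+ 2)
       - C * s2 * (\sum_b q ^+ T b * (T b)%:R)).
      rewrite block_fluct_centered block_fluct_sqr -/block_length_mean.
      by ring.
    rewrite !mulr_sumr -big_split/= -sumrB; apply: eq_bigr => b _; ring.
  rewrite [X in geom_cvg _ X]E0.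
  apply: (geom_cvg_sum _ (a := fun b m => q ^+ T b *
     (2 * Y b * first_moment (m - T b) + (Y b ^+ 2 - s2 * (T b)%:R) * mass (m - T b)))
    (l := fun b => q ^+ T b * (2 * Y b * A + (Y b ^+ 2 - s2 * (T b)%:R) * C))) => b.
  apply: geom_cvgZ.
  by apply: geom_cvgD; apply: geom_cvgZ; exact: geom_cvg_subn.
move=> m Lm; rewrite {1}/second_moment wsum_rec// mass_rec// -big_split/=.
rewrite mulr_sumr -sumrB; apply: eq_bigr => b _; rewrite wsum_sqr add0r.
have /andP[_ TL] := T_bounds b; rewrite natrB; last exact: leq_trans Lm.
by ring.
Qed.


(** The Gaussian prediction for [wsum m f x] divided by [mass m]: the heat semigroup after a time at
    which the variance is [s2 * m]. *)
Definition heat m (f : R -> R) (x : R) : R :=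
  gauss_mean (fun z => f (x + Num.sqrt (s2 * m%:R) * z)).

Let s2_ge0 : 0 <= s2. Proof. exact/ltW/diffusivity_gt0. Qed.

Lemma heat_split m n (f : R -> R) x : (n <= m)%N -> continuous f ->
  (forall y, 0 <= f y <= 1) ->
  heat m f x = gauss_mean (fun w => gauss_mean (fun z =>
    f (x + Num.sqrt (s2 * n%:R) * w + Num.sqrt (s2 * (m - n)%:R) * z))).
Proof.
move=> nm cf f01; rewrite (@gauss_mean_semigroup _ f cf f01 x _ _ (Num.sqrt (s2 * m%:R))) ?sqrtr_ge0//.
by rewrite !sqr_sqrtr ?(mulr_ge0 s2_ge0)// natrB//; ring.
Qed.

(** The coefficient of [F] in the two Taylor errors of [block_step_taylor]; the summand with [0 : R]
    comes from the side without displacement. *)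
Definition step_error : R := \sum_b q ^+ T b *
    (4 * (`|Y b| ^+ 3 + `|Num.sqrt (s2 * (L - T b)%:R)| ^+ 3 * gauss_abs3)) +
  4 * (`|0 : R| ^+ 3 + `|Num.sqrt (s2 * L%:R)| ^+ 3 * gauss_abs3).

Lemma step_error_ge0 : 0 <= step_error.
Proof.
have g0 := @gauss_abs3_ge0 R.
rewrite addr_ge0//; last first.
  by rewrite mulr_ge0// addr_ge0// ?mulr_ge0// ?exprn_ge0.
apply: sumr_ge0 => b _; rewrite mulr_ge0 ?(ltW (p_gt0 b))// mulr_ge0//.
by rewrite addr_ge0// ?mulr_ge0// ?exprn_ge0.
Qed.

(* The drift and diffusivity are chosen so that the expansions of both sides
   agree up to second order. *)
Lemma block_step_taylor (f f1 f2 : R -> R) (F1 F : R) y :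
  smooth_test f f1 f2 F1 F ->
  `|\sum_b q ^+ T b * gauss_mean (fun z =>
       f (y + Y b + Num.sqrt (s2 * (L - T b)%:R) * z)) -
    gauss_mean (fun z => f (y + Num.sqrt (s2 * L%:R) * z))| <= step_error * F.
Proof.
move=> tf; pose P b := f y + Y b * f1 y + (Y b ^+ 2 + s2 * (L - T b)%:R) / 2 * f2 y.
pose PL := f y + 0 * f1 y + (0 ^+ 2 + s2 * L%:R) / 2 * f2 y.
have PE : \sum_b q ^+ T b * P b = PL.
  transitivity (f y * (\sum_b q ^+ T b) + f1 y * (\sum_b q ^+ T b * Y b) +
    f2 y / 2 * (\sum_b q ^+ T b * Y b ^+ 2) + s2 * L%:R / 2 * f2 y * (\sum_b q ^+ T b) -
    s2 / 2 * f2 y * (\sum_b q ^+ T b * (T b)%:R)).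
    rewrite !mulr_sumr -!big_split/= -sumrB; apply: eq_bigr => b _.
    rewrite /P natrB; last by case/andP: (T_bounds b).
    by ring.
  rewrite sum_q block_fluct_centered block_fluct_sqr -/block_length_mean /PL.
  by ring.
rewrite -(subrK PL (\sum_b _)) -addrA /step_error mulrDl.
apply: (le_trans (ler_normD _ _)); apply: lerD.
  rewrite -PE -sumrB (le_trans (ler_norm_sum _ _ _))// mulr_suml ler_sum// => b _.
  rewrite -mulrBr normrM (ger0_norm (ltW (p_gt0 b))) -mulrA ler_wpM2l ?(ltW (p_gt0 b))//.
  have := gauss_mean_taylor tf y (Y b) (Num.sqrt (s2 * (L - T b)%:R)).
  by rewrite sqr_sqrtr ?(mulr_ge0 s2_ge0)// [F * _]mulrC.
have := gauss_mean_taylor tf y 0 (Num.sqrt (s2 * L%:R)).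
by rewrite sqr_sqrtr ?(mulr_ge0 s2_ge0)// addr0 distrC [F * _]mulrC.
Qed.

(** All terms share m - L units of Gaussian evolution. Conditioning on this common increment [w]
    reduces the claim to [block_step_taylor] at x + sA w, with an error independent of [m]. *)
Lemma heat_step (f f1 f2 : R -> R) (F1 F : R) m x : (L <= m)%N ->
  smooth_test f f1 f2 F1 F ->
  `|\sum_b q ^+ T b * heat (m - T b) f (x + Y b) - heat m f x| <= step_error * F.
Proof.
move=> Lm tf; have [cf f01 _ _] := tf.
rewrite (heat_split x (leq_subr L m) cf f01) subKn//.
under eq_bigr => b _.
  have /andP[_ TL] := T_bounds b.
  rewrite (heat_split (n := (m - L)%N) (x + Y b) _ cf f01); last exact: leq_sub2l.
  rewrite (_ : m - T b - (m - L) = L - T b)%N; last by move: TL Lm; clear; lia.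
  over.
set sA := Num.sqrt (s2 * (m - L)%:R).
pose G b w := gauss_mean (fun z => f (x + Y b + sA * w + Num.sqrt (s2 * (L - T b)%:R) * z)).
have iG b : gauss_integrable (G b) by exact: gauss_integrable_mean_affine.
have iqG b : gauss_integrable (fun w => q ^+ T b * G b w) by exact: gauss_integrableZ.
have -> : \sum_b q ^+ T b * gauss_mean (G b) =
    gauss_mean (fun w => \sum_b q ^+ T b * G b w).
  by rewrite gauss_mean_sum//; apply: eq_bigr => b _; rewrite gauss_meanZ.
rewrite -gauss_meanB; last 2 first.
- exact: gauss_integrable_sum.
- exact: gauss_integrable_mean_affine.
rewrite -[leRHS]gauss_mean_cst; apply: gauss_mean_norm_le.
- apply: measurable_funB; last exact: measurable_gauss_mean_affine.
  apply: measurable_sum => b; apply: measurable_funM => //.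
  exact: measurable_gauss_mean_affine.
- exact: gauss_integrable_cst.
move=> w; have := block_step_taylor (x + sA * w) tf.
rewrite /G; under eq_bigr do rewrite -[x + sA * w + _]addrA [sA * w + _]addrC addrA.
by [].
Qed.

(** The bound is uniform in [m] because the two times differ by at most [L]. In [wsum_heat] it
    multiplies the geometrically small deviation of [mass] from its limit. *)
Lemma heat_lipschitz (f f1 f2 : R -> R) (F1 F : R) m t x d :
  smooth_test f f1 f2 F1 F -> (t <= m)%N -> (t <= L)%N ->
  `|heat (m - t) f (x + d) - heat m f x| <=
    F1 * (`|d| + Num.sqrt (s2 * L%:R) * gauss_abs1).
Proof.
move=> tf tm tL; apply: (le_trans (gauss_mean_lipschitz tf _ _ _ _)).
rewrite ler_wpM2l ?(smooth_test_F1_ge0 tf)// lerD2l ler_wpM2r ?gauss_abs1_ge0//.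
apply: (le_trans (sqrt_dist _ _)); rewrite ?(mulr_ge0 s2_ge0)//.
  by rewrite ler_wpM2l// ler_nat leq_subr.
by rewrite ler_wsqrtr// -mulrBr ler_wpM2l// natrB// opprB addrC subrK ler_nat.
Qed.


Lemma ler_sum_weights (a : B -> R) k : (forall b, a b <= k) ->
  \sum_b q ^+ T b * a b <= k.
Proof.
move=> ak; rewrite -[leRHS]mul1r -sum_q mulr_suml; apply: ler_sum => b _.
by rewrite ler_wpM2l ?(ltW (p_gt0 b)).
Qed.

Lemma sum_geometric_le (r : R) n : 0 < r -> r < 1 ->
  \sum_(j < n) r ^+ j <= (1 - r)^-1.
Proof.
move=> r0 r1; have r10 : 0 < 1 - r by rewrite subr_gt0.
rewrite -[leRHS]mul1r ler_pdivlMr// mulrC -opprB mulNr -subrX1 opprB.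
by rewrite lerBlDr lerDl exprn_ge0// ltW.
Qed.

Let lip : R := (\sum_b `|Y b|) + Num.sqrt (s2 * L%:R) * gauss_abs1.

Let heat_lip (f f1 f2 : R -> R) (F1 F : R) m x b : (L <= m)%N ->
  smooth_test f f1 f2 F1 F ->
  `|heat (m - T b) f (x + Y b) - heat m f x| <= lip * F1.
Proof.
move=> Lm tf; have /andP[_ TL] := T_bounds b.
apply: (le_trans (heat_lipschitz x (Y b) tf (leq_trans TL Lm) TL)).
rewrite mulrC ler_wpM2r ?(smooth_test_F1_ge0 tf)// lerD2r.
by rewrite (bigD1 b)//= lerDl sumr_ge0.
Qed.

(* Lindeberg's replacement argument, run along the renewal recursion. *)
Theorem wsum_heat : exists2 K, 0 <= K & forall (f f1 f2 : R -> R) (F1 F : R),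
  smooth_test f f1 f2 F1 F -> forall m x,
  `|wsum m f x - mass m * heat m f x| <= K * (F1 + m%:R * F).
Proof.
have [C C0 [M [r [M0 r0 r1 aC]]]] := mass_cvg.
have g1 := @gauss_abs1_ge0 R; have K0 := step_error_ge0.
have r10 : 0 < 1 - r by rewrite subr_gt0.
have lip0 : 0 <= lip by rewrite addr_ge0// ?sumr_ge0// mulr_ge0// sqrtr_ge0.
(* The factor r^(-L) pays for replacing m - T b by m in the rate. *)
pose c := M / r ^+ L * lip.
have c0 : 0 <= c by rewrite mulr_ge0// divr_ge0// exprn_ge0// ltW.
pose E m := q ^+ m * \sum_(0 <= N < h m)
   (`|kap N - mu * m%:R| + Num.sqrt (s2 * m%:R) * gauss_abs1).
have E0 m : 0 <= E m.
  rewrite mulr_ge0 ?exprn_ge0 ?(ltW q_gt0)//; apply: sumr_ge0 => N _.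
  by rewrite addr_ge0// mulr_ge0 ?sqrtr_ge0.
pose Kb := \sum_(m < L) E m.
have Kb0 : 0 <= Kb by exact: sumr_ge0.
exists (Kb + C * step_error + c / (1 - r)).
  by apply: addr_ge0; [apply: addr_ge0 => //; rewrite mulr_ge0// ltW|rewrite divr_ge0// ltW].
move=> f f1 f2 F1 F tf.
have F10 := smooth_test_F1_ge0 tf; have F0 := smooth_test_F_ge0 tf.
(* The three terms collect the lengths below [L], at most [m] Taylor errors, and the deviations of
   [mass] from its limit. *)
pose bnd m := Kb * F1 + m%:R * (C * (step_error * F)) + c * F1 * \sum_(j < m.+1) r ^+ j.
have CK0 : 0 <= C * (step_error * F) by rewrite mulr_ge0 ?(ltW C0)// mulr_ge0.
have cF0 : 0 <= c * F1 by exact: mulr_ge0.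
have rX0 n : 0 <= r ^+ n by rewrite exprn_ge0// ltW.
have bnd_le m n : (m <= n)%N -> bnd m <= bnd n.
  move=> mn; apply: lerD; first by rewrite lerD2l ler_wpM2r// ler_nat.
  rewrite ler_wpM2l// -(subnKC mn) -addSn big_split_ord/= lerDl.
  exact: sumr_ge0.
have bndS m : bnd m.+1 = bnd m + C * (step_error * F) + c * F1 * r ^+ m.+1.
  by rewrite /bnd [in LHS]big_ord_recr/= -[m.+1%:R]natr1; ring.
have key m x : `|wsum m f x - mass m * heat m f x| <= bnd m.
  elim/ltn_ind: m x => m IH x; have [mL|Lm] := ltnP m L.
    apply: (@le_trans _ _ (Kb * F1)); last first.
      rewrite /bnd -addrA lerDl addr_ge0//; first by rewrite mulr_ge0.
      by rewrite mulr_ge0// sumr_ge0.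
    apply: (@le_trans _ _ (E m * F1)); last first.
      by rewrite ler_wpM2r// /Kb (bigD1 (Ordinal mL))//= lerDl sumr_ge0.
    rewrite massE /wsum -mulrA -mulrBr normrM ger0_norm ?exprn_ge0 ?(ltW q_gt0)//.
    rewrite /E -mulrA ler_wpM2l ?exprn_ge0 ?(ltW q_gt0)//.
    have -> : (h m)%:R * heat m f x = \sum_(0 <= N < h m) heat m f x.
      by rewrite sumr_const_nat subn0 [LHS]mulr_natl.
    rewrite -sumrB (le_trans (ler_norm_sum _ _ _))// mulr_suml ler_sum// => N _.
    rewrite -[in X in `|f X - _|]addrA.
    have := lipschitz_vs_gauss_mean tf x (kap N - mu * m%:R) (Num.sqrt (s2 * m%:R)).
    by rewrite (ger0_norm (sqrtr_ge0 _)) [F1 * _]mulrC.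
  (* Putting the constant [C] in place of [mass (m - T b)] in the middle sum makes the cancellation
     of [heat_step] available; what remains is a product of two differences. *)
  have -> : wsum m f x - mass m * heat m f x =
      \sum_b q ^+ T b * (wsum (m - T b) f (x + Y b) - mass (m - T b) * heat (m - T b) f (x + Y b))
    + C * (\sum_b q ^+ T b * heat (m - T b) f (x + Y b) - heat m f x)
    + \sum_b q ^+ T b * ((mass (m - T b) - C) * (heat (m - T b) f (x + Y b) - heat m f x)).
    rewrite wsum_rec// mass_rec// mulrBr mulr_sumr mulr_suml.
    have -> : C * heat m f x = \sum_b q ^+ T b * (C * heat m f x).
      by rewrite -mulr_suml sum_q mul1r.
    by rewrite -!sumrB -!big_split/=; apply: eq_bigr => b _; ring.
  have m0 : (0 < m)%N by move: Lm L_gt1; clear; lia.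
  have -> : bnd m = bnd m.-1 + C * (step_error * F) + c * F1 * r ^+ m.
    by have := bndS m.-1; rewrite prednK.
  apply: (le_trans (ler_normD _ _)); apply: lerD.
    apply: (le_trans (ler_normD _ _)); apply: lerD.
      apply: (le_trans (ler_norm_sum _ _ _)).
      under eq_bigr do rewrite normrM (ger0_norm (ltW (p_gt0 _))).
      apply: ler_sum_weights => b; have /andP[T1 TL] := T_bounds b.
      have bm : (m - T b <= m.-1)%N by move: T1; clear; lia.
      apply: le_trans (bnd_le _ _ bm); apply: IH.
      by move: bm m0; clear; lia.
    by rewrite normrM (gtr0_norm C0) ler_wpM2l ?(ltW C0)// (heat_step x Lm tf).
  apply: (le_trans (ler_norm_sum _ _ _)).
  under eq_bigr do rewrite normrM (ger0_norm (ltW (p_gt0 _))).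
  apply: ler_sum_weights => b; have /andP[T1 TL] := T_bounds b.
  have -> : c * F1 * r ^+ m = (M / r ^+ L * r ^+ m) * (lip * F1) by rewrite /c; ring.
  rewrite normrM ler_pM//; last exact: heat_lip Lm tf.
  apply: (le_trans (aC _)); rewrite -mulrA ler_wpM2l//.
  rewrite mulrC ler_pdivlMr ?exprn_gt0// -exprD (ler_wiXn2l (ltW r0) (ltW r1))//.
  by move: TL Lm; clear; lia.
move=> m x; apply: (le_trans (key m x)); rewrite /bnd.
have h1 : c * F1 * \sum_(j < m.+1) r ^+ j <= c * F1 * (1 - r)^-1.
  by rewrite ler_wpM2l// sum_geometric_le.
have mF0 : 0 <= m%:R * F by rewrite mulr_ge0.
have h2 : 0 <= Kb * (m%:R * F) by rewrite mulr_ge0.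
have h3 : 0 <= C * step_error * F1 by rewrite mulr_ge0// mulr_ge0// ltW.
have h4 : 0 <= c / (1 - r) * (m%:R * F) by rewrite mulr_ge0// divr_ge0// ltW.
move: h1 h2 h3 h4; move: ((1 - r)^-1) (\sum_(j < _) _) => u v.
by move=> *; lra.
Qed.


(** * From windows to shells *)

Definition shell_mean n (g : R -> R) : R :=
  (\sum_(h n <= N < h n.+1) g (kap N)) / (h n.+1 - h n)%:R.

(* Words of length [n.+1] minus those beginning with the one-letter block [0]. *)
Let shellw n (g : R -> R) : R := wsum n.+1 g 0 - q * wsum n g (- mu).

Let shellwE n g : shellw n g =
  q ^+ n.+1 * \sum_(h n <= N < h n.+1) g (kap N - mu * n.+1%:R).
Proof.
rewrite /shellw /wsum.
have -> : \sum_(0 <= N < h n) g (- mu + kap N - mu * n%:R) =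
    \sum_(0 <= N < h n) g (kap N - mu * n.+1%:R).
  by apply: eq_bigr => N _; congr g; rewrite -[n.+1%:R]natr1; ring.
under eq_bigr do rewrite add0r.
by rewrite (big_cat_nat (n := h n))//= exprS; ring.
Qed.

Let shellw1 n : shellw n (fun=> 1) = q ^+ n.+1 * (h n.+1 - h n)%:R.
Proof. by rewrite shellwE sumr_const_nat. Qed.

Let shell_mean_shift n g :
  shell_mean n (fun y => g (y - mu * n.+1%:R)) = shellw n g / shellw n (fun=> 1).
Proof.
rewrite shellw1 shellwE /shell_mean invfM mulrACA.
by rewrite divff ?mul1r// expf_neq0// gt_eqF.
Qed.

(** The weight of the shell tends to C (1 - q) > 0, and [k] is half of that; dividing by the weight
    therefore preserves all orders of magnitude. *)
Let shellw1_lower : exists k n0, 0 < k /\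
  forall n, (n0 <= n)%N -> k <= shellw n (fun=> 1).
Proof.
have [C C0 aC] := mass_cvg.
have /geom_cvg_cvgn cv : geom_cvg (fun n => mass n - q * mass (n - 1)) (C - q * C).
  rewrite (_ : (fun n => _) = fun n => mass n + (- q) * mass (n - 1)); last first.
    by apply/funext => n; rewrite mulNr.
  rewrite -mulNr; apply: geom_cvgD => //; apply: geom_cvgZ; exact: geom_cvg_subn.
have k0 : 0 < (C - q * C) / 2.
  by rewrite -{1}[C]mul1r -mulrBl divr_gt0// mulr_gt0// subr_gt0.
have : (C - q * C) / 2 < C - q * C by lra.
move=> /(cvgr_gt _ cv)[n0 _ hn0]; exists ((C - q * C) / 2), n0; split=> // n n0n.
have := hn0 n.+1; rewrite /= subn1/= => /(_ (leqW n0n)) /ltW.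
by rewrite /shellw !wsum_cst !mul1r.
Qed.

Let shellw_id_bounded : exists2 K, 0 <= K & forall n, `|shellw n id| <= K.
Proof.
have [C _ /geom_cvg_bounded[Ka Ka0 bA]] := mass_cvg.
have [A /geom_cvg_bounded[Kf Kf0 bF]] := first_moment_cvg.
have mu0 := ltW drift_gt0; have q0 := ltW q_gt0.
exists (Kf + q * (Kf + mu * Ka)).
  by rewrite addr_ge0// mulr_ge0// addr_ge0// mulr_ge0.
move=> n; rewrite /shellw !wsum_id mul0r addr0.
apply: (le_trans (ler_normB _ _)); apply: lerD => //.
rewrite normrM ger0_norm// ler_wpM2l// (le_trans (ler_normD _ _))// lerD//.
by rewrite mulNr normrN normrM ger0_norm// ler_wpM2l.
Qed.

Let shellw_sqr_bounded : exists2 K, 0 <= K & forall n,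
  `|shellw n (fun y => y ^+ 2) - s2 * n.+1%:R * shellw n (fun=> 1)| <= K.
Proof.
have [C _ /geom_cvg_bounded[Ka Ka0 bA]] := mass_cvg.
have [A /geom_cvg_bounded[Kf Kf0 bF]] := first_moment_cvg.
have [V /geom_cvg_bounded[Kv Kv0 bV]] := second_moment_cvg.
have mu0 := ltW drift_gt0; have q0 := ltW q_gt0.
have h0 : 0 <= 2 * q * mu by rewrite mulr_ge0// mulr_ge0.
exists (Kv + q * Kv + q * `|s2 - mu ^+ 2| * Ka + 2 * q * mu * Kf).
  apply: addr_ge0 (mulr_ge0 h0 Kf0).
  apply: addr_ge0 (mulr_ge0 (mulr_ge0 q0 (normr_ge0 _)) Ka0).
  exact: addr_ge0 Kv0 (mulr_ge0 q0 Kv0).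
move=> n; rewrite /shellw !wsum_sqr !wsum_cst !mul1r.
have -> : second_moment n.+1 + 2 * 0 * first_moment n.+1 + 0 ^+ 2 * mass n.+1 -
    q * (second_moment n + 2 * - mu * first_moment n + (- mu) ^+ 2 * mass n) -
    s2 * n.+1%:R * (mass n.+1 - q * mass n) =
    (second_moment n.+1 - s2 * n.+1%:R * mass n.+1)
    - q * (second_moment n - s2 * n%:R * mass n)
    + q * (s2 - mu ^+ 2) * mass n + 2 * q * mu * first_moment n.
  by rewrite -natr1; ring.
apply: (le_trans (ler_normD _ _)); apply: lerD.
  apply: (le_trans (ler_normD _ _)); apply: lerD.
    apply: (le_trans (ler_normB _ _)); apply: lerD => //.
    by rewrite normrM ger0_norm// ler_wpM2l.
  rewrite normrM [X in X * _ <= _]normrM (ger0_norm q0); apply: ler_wpM2l => //; exact: mulr_ge0.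
by rewrite normrM ger0_norm// ler_wpM2l.
Qed.

Lemma shell_mean_drift : exists K n0, forall n, (n0 <= n)%N ->
  (h n < h n.+1)%N /\ `|shell_mean n id - mu * n.+1%:R| <= K.
Proof.
have [k [n0 [k0 hk]]] := shellw1_lower; have [K K0 hK] := shellw_id_bounded.
exists (K / k), n0 => n n0n; have s1 := hk n n0n.
have s10 : 0 < shellw n (fun=> 1) by exact: lt_le_trans s1.
have hn : (h n < h n.+1)%N.
  move: s10; rewrite shellw1 pmulr_rgt0 ?exprn_gt0// ltr0n; clear; lia.
split => //; have := shell_mean_shift n id.
have -> : shell_mean n (fun y => y - mu * n.+1%:R) = shell_mean n id - mu * n.+1%:R.
  rewrite /shell_mean sumrB sumr_const_nat mulrBl -[X in _ - X / _]mulr_natr mulfK//.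
  by rewrite pnatr_eq0; move: hn; clear; lia.
move=> ->; rewrite normrM normfV (gtr0_norm s10) ler_pM ?invr_ge0 ?(ltW s10)//.
by rewrite lef_pV2.
Qed.

(** Centring at the mean instead of [mu * n.+1] lowers the second moment by the squared distance of
    the two centres, which [shell_mean_drift] bounds. *)
Lemma shell_mean_variance : exists K n0, forall n, (n0 <= n)%N ->
  `|shell_mean n (fun y => (y - shell_mean n id) ^+ 2) - s2 * n.+1%:R| <= K.
Proof.
have [k [n0 [k0 hk]]] := shellw1_lower; have [K K0 hK] := shellw_sqr_bounded.
have [K1 [n1 h1]] := shell_mean_drift.
exists (K / k + K1 ^+ 2), (maxn n0 n1) => n; rewrite geq_max => /andP[n0n n1n].
have [hn e1] := h1 n n1n; have s1 := hk n n0n.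
have s10 : 0 < shellw n (fun=> 1) by exact: lt_le_trans s1.
pose d := (h n.+1 - h n)%:R : R.
have d0 : d != 0 by rewrite pnatr_eq0; move: hn; clear; lia.
set a := shell_mean n id; pose e := a - mu * n.+1%:R.
have -> : shell_mean n (fun y => (y - a) ^+ 2) =
    shell_mean n (fun y => (y - mu * n.+1%:R) ^+ 2) - e ^+ 2.
  rewrite /shell_mean; under eq_bigr => N _.
    rewrite (_ : (kap N - a) ^+ 2 = (kap N - mu * n.+1%:R) ^+ 2 +
      (- (2 * e)) * kap N + (a ^+ 2 - (mu * n.+1%:R) ^+ 2)); last by rewrite /e; ring.
    over.
  rewrite 2!big_split/= -mulr_sumr sumr_const_nat -[(a ^+ 2 - _) *+ _]mulr_natr -/d.
  have -> : \sum_(h n <= N < h n.+1) kap N = a * d by rewrite /a /shell_mean divfK.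
  by rewrite /e; field.
rewrite (shell_mean_shift n (fun y => y ^+ 2)) addrAC.
apply: (le_trans (ler_normB _ _)); apply: lerD; last first.
  by rewrite normrX lerXn2r ?nnegrE// (le_trans _ e1).
have -> : shellw n (fun y => y ^+ 2) / shellw n (fun=> 1) - s2 * n.+1%:R =
  (shellw n (fun y => y ^+ 2) - s2 * n.+1%:R * shellw n (fun=> 1)) / shellw n (fun=> 1).
  by field; rewrite gt_eqF.
rewrite normrM normfV (gtr0_norm s10) ler_pM ?invr_ge0 ?(ltW s10)//.
by rewrite lef_pV2.
Qed.

(** The removed words start with [0], so their prediction is [heat n f (- mu)]; replacing it by
    [heat n.+1 f 0] costs only a multiple of F1. *)
Theorem shell_mean_heat : exists K n0, 0 <= K /\
  forall (f f1 f2 : R -> R) (F1 F : R), smooth_test f f1 f2 F1 F ->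
  forall n, (n0 <= n)%N ->
  `|shell_mean n (fun y => f (y - mu * n.+1%:R)) - heat n.+1 f 0|
    <= K * (F1 + n.+1%:R * F).
Proof.
have [k [n0 [k0 hk]]] := shellw1_lower.
have [K K0 hK] := wsum_heat.
have [C _ /geom_cvg_bounded[Ka Ka0 bA]] := mass_cvg.
have q0 := ltW q_gt0.
have lip0 : 0 <= lip.
  by rewrite addr_ge0// ?sumr_ge0// mulr_ge0// ?sqrtr_ge0// gauss_abs1_ge0.
exists ((K + q * K + q * (Ka * lip)) / k), n0; split.
  apply: divr_ge0 (ltW k0); apply: addr_ge0 (mulr_ge0 q0 (mulr_ge0 Ka0 lip0)).
  exact: addr_ge0 K0 (mulr_ge0 q0 K0).
move=> f f1 f2 F1 F tf n n0n; have s1 := hk n n0n.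
have F10 := smooth_test_F1_ge0 tf; have F0 := smooth_test_F_ge0 tf.
have s10 : 0 < shellw n (fun=> 1) by exact: lt_le_trans s1.
rewrite shell_mean_shift.
have -> : shellw n f / shellw n (fun=> 1) - heat n.+1 f 0 =
  (shellw n f - heat n.+1 f 0 * shellw n (fun=> 1)) / shellw n (fun=> 1).
  by field; rewrite gt_eqF.
rewrite normrM normfV (gtr0_norm s10) [leRHS]mulrAC.
rewrite ler_pM ?invr_ge0 ?(ltW s10)//; last by rewrite lef_pV2.
have -> : shellw n f - heat n.+1 f 0 * shellw n (fun=> 1) =
  (wsum n.+1 f 0 - mass n.+1 * heat n.+1 f 0)
  - q * (wsum n f (- mu) - mass n * heat n f (- mu))
  - q * (mass n * (heat n f (- mu) - heat n.+1 f 0)).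
  by rewrite /shellw !wsum_cst; ring.
have nF : n%:R * F <= n.+1%:R * F by rewrite ler_wpM2r// ler_nat.
have nF0 : 0 <= n.+1%:R * F by rewrite mulr_ge0.
rewrite [leRHS]mulrDl [X in _ <= X + _]mulrDl.
apply: (le_trans (ler_normB _ _)); apply: lerD.
  apply: (le_trans (ler_normB _ _)); apply: lerD; first exact: hK tf _ _.
  rewrite normrM (ger0_norm q0) -[leRHS]mulrA ler_wpM2l// (le_trans (hK _ _ _ _ _ tf _ _))//.
  by rewrite ler_wpM2l// lerD2l.
rewrite normrM (ger0_norm q0) normrM -[leRHS]mulrA -[Ka * lip * _]mulrA ler_wpM2l//.
apply: (@le_trans _ _ (Ka * (lip * F1))); last first.
  by rewrite ler_wpM2l// ler_wpM2l// lerDl.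
rewrite ler_pM//; have := heat_lipschitz 0 (- mu) tf (ltn0Sn n) (ltnW L_gt1).
rewrite subn1/= add0r => /le_trans; apply; rewrite mulrC ler_wpM2r// lerD2r.
(* The shift [- mu] equals [Y b0], so its norm is one of the terms of [lip]. *)
rewrite (bigD1 b0)//= /block_fluct D_b0 T_b0 sub0r mulr1 lerDl.
exact: sumr_ge0.
Qed.

Definition shell_variance n : R :=
  shell_mean n (fun y => (y - shell_mean n id) ^+ 2).

Let shell_mean_le n (g g' : R -> R) : (forall y, g y <= g' y) ->
  shell_mean n g <= shell_mean n g'.
Proof.
by move=> gg'; rewrite ler_wpM2r ?invr_ge0// ler_sum.
Qed.

Let shell_meanD_cst n g k : (h n < h n.+1)%N ->
  shell_mean n (fun y => g y + k) = shell_mean n g + k.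
Proof.
move=> hn; rewrite /shell_mean big_split/= sumr_const_nat mulrDl.
rewrite -[X in _ + X / _]mulr_natr mulfK//.
by rewrite pnatr_eq0; move: hn; clear; lia.
Qed.

Lemma sqrt_index_large (A : R) : exists n1, forall n, (n1 <= n)%N ->
  A <= Num.sqrt (s2 * n.+1%:R).
Proof.
have s20 := diffusivity_gt0.
have A0 : 0 <= A ^+ 2 / s2 by rewrite divr_ge0// ?sqr_ge0.
exists (Num.bound (A ^+ 2 / s2)) => n nA.
have An : A ^+ 2 <= s2 * n.+1%:R.
  rewrite mulrC -ler_pdivrMr//; apply: (le_trans (ltW (archi_boundP A0))).
  by rewrite ler_nat leqW.
rewrite (le_trans (ler_norm A))// -(@ler_pXn2r _ 2%N) ?nnegrE ?sqrtr_ge0//.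
by rewrite real_normK ?num_real// sqr_sqrtr// (le_trans _ An)// sqr_ge0.
Qed.

(** Standardising by the true mean and variance instead of [mu * n.+1] and [s2 * n.+1] only moves
    the threshold from [x] to a nearby [xn]. The indicator at [xn] is then squeezed between logistic
    functions centred at x - 2 dl and x + 2 dl, up to e'. *)
Theorem shell_clt (x : R) :
  (forall e, 0 < e -> exists2 d, 0 < d & forall y, `|y - x| <= d ->
     `|gauss_cdf y - gauss_cdf x| <= e) ->
  forall e, 0 < e -> exists n1, forall n, (n1 <= n)%N ->
  `|shell_mean n (fun y =>
       ((y - shell_mean n id) / Num.sqrt (shell_variance n) <= x)%R%:R)
    - gauss_cdf x| <= e.
Proof.
move=> cont e e0; pose e' := e / 4.
have e'0 : 0 < e' by rewrite divr_gt0.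
have [d d0 dcont] := cont _ e'0.
(* The farthest points at which continuity is used are x - 3 dl and x + 3 dl. *)
pose dl := d / 3; have dl0 : 0 < dl by rewrite divr_gt0.
pose ep := dl * e'; have ep0 : 0 < ep by rewrite mulr_gt0.
have epE : ep / dl = e' by rewrite /ep mulrAC divff ?mul1r// gt_eqF.
have s20 := diffusivity_gt0.
have [K1 [n1 mK1]] := shell_mean_drift.
have [K2 [n2 vK2]] := shell_mean_variance.
have [K [n3 [K0 hK]]] := shell_mean_heat.
(* A deviation [sg] above [A1] keeps [xn] within [dl] of [x], above [A2] it bounds the replacement
   error by e', and above |K2| + 1 it makes the variance positive. *)
pose A1 := (`|x| * Num.sqrt `|K2| + `|K1|) / dl.
pose A2 := K * (1 + (s2 * ep ^+ 2)^-1) / (ep * e').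
have A10 : 0 <= A1 by rewrite divr_ge0 ?(ltW dl0)// addr_ge0// mulr_ge0// sqrtr_ge0.
have A20 : 0 <= A2.
  apply: divr_ge0; last exact/ltW/mulr_gt0.
  apply: mulr_ge0 => //; apply: addr_ge0 => //.
  by rewrite invr_ge0 ltW// mulr_gt0// exprn_gt0.
have [n4 sA] := sqrt_index_large (A1 + A2 + `|K2| + 1).
exists (maxn (maxn n1 n2) (maxn n3 n4)) => n.
rewrite !geq_max => /andP[/andP[n1n n2n] /andP[n3n n4n]].
have [hn mn] := mK1 n n1n; have vn := vK2 n n2n; have sn := sA n n4n.
rewrite -/(shell_variance n) in vn.
set m := shell_mean n id in mn *; set V := shell_variance n in vn *.
set sg := Num.sqrt (s2 * n.+1%:R) in sn *.
have sg2 : sg ^+ 2 = s2 * n.+1%:R by rewrite sqr_sqrtr// mulr_ge0// ltW.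
have K20 : 0 <= `|K2| by [].
have sg1 : 1 <= sg by lra.
have sg0 : 0 < sg by lra.
have V0 : 0 < V.
  have : sg <= sg ^+ 2 by rewrite expr2 ler_peMl// ltW.
  have := ler_norm K2; move: vn; rewrite -sg2 ler_norml => /andP[? ?] *; lra.
have sV0 : 0 < Num.sqrt V by rewrite sqrtr_gt0.
pose u y := (y - mu * n.+1%:R) / sg.
pose xn := (x * Num.sqrt V + (m - mu * n.+1%:R)) / sg.
have uxn y : ((y - m) / Num.sqrt V <= x) = (u y <= xn).
  rewrite ler_pdivrMr// /u /xn ler_pM2r ?invr_gt0//.
  by apply/idP/idP; lra.
have xnx : `|xn - x| <= dl.
  have -> : xn - x = (x * (Num.sqrt V - sg) + (m - mu * n.+1%:R)) / sg.
    by rewrite /xn; field; rewrite gt_eqF.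
  rewrite normrM normfV (gtr0_norm sg0) ler_pdivrMr//.
  apply: (@le_trans _ _ (`|x| * Num.sqrt `|K2| + `|K1|)).
    apply: (le_trans (ler_normD _ _)); apply: lerD; last exact: le_trans mn (ler_norm _).
    rewrite normrM ler_wpM2l//.
    have vK : `|V - s2 * n.+1%:R| <= `|K2| by exact: le_trans vn (ler_norm _).
    have sE0 : 0 <= s2 * n.+1%:R by rewrite -sg2 sqr_ge0.
    have [Vs|sV] := leP V (s2 * n.+1%:R).
      rewrite (le_trans (sqrt_dist (ltW V0) Vs))// ler_wsqrtr//.
      by rewrite (le_trans _ vK)// distrC ler_norm.
    rewrite distrC (le_trans (sqrt_dist sE0 (ltW sV)))// ler_wsqrtr//.
    by rewrite (le_trans _ vK)// ler_norm.
  have -> : `|x| * Num.sqrt `|K2| + `|K1| = dl * A1.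
    by rewrite /A1 [RHS]mulrC divfK// gt_eqF.
  by rewrite ler_wpM2l ?(ltW dl0)//; lra.
(* The slope of (u y - ctr) / ep as a function of y. *)
pose k := (sg * ep)^-1.
have k0 : 0 < k by rewrite invr_gt0 mulr_gt0.
have err : K * (1 * k + n.+1%:R * (1 * k ^+ 3)) <= e'.
  have -> : K * (1 * k + n.+1%:R * (1 * k ^+ 3)) = A2 * e' / sg.
    have -> : n.+1%:R = sg ^+ 2 / s2 by rewrite sg2 mulrAC divff ?mul1r// gt_eqF.
    by rewrite /A2 /k; field; rewrite !gt_eqF.
  rewrite ler_pdivrMr// [leRHS]mulrC ler_wpM2r ?(ltW e'0)//; lra.
have smooth ctr : `|shell_mean n (fun y => logistic ((u y - ctr) / ep)) -
    gauss_mean (fun z => logistic ((z - ctr) / ep))| <= e'.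
  have ts := smooth_test_affine (- (ctr / ep)) (ltW k0) (@smooth_test_logistic R).
  have := le_trans (hK _ _ _ _ _ ts n n3n) err.
  rewrite /heat.
  rewrite (_ : (fun z => _ (_ * (0 + _ * z) + _)) = (fun z => logistic ((z - ctr) / ep))).
    rewrite (_ : (fun y => _ (_ * (y - _) + _)) = (fun y => logistic ((u y - ctr) / ep)))//.
    apply/funext => y; congr logistic; rewrite /u /k; field; by rewrite !gt_eqF.
  apply/funext => z; congr logistic; rewrite -/sg /k; field; by rewrite !gt_eqF.
move: xnx; rewrite ler_distl => /andP[xl xu].
have /dcont : `|x + 2 * dl + dl - x| <= d.
  have -> : x + 2 * dl + dl - x = d by rewrite /dl; field.
  by rewrite ger0_norm// ltW.
have /dcont : `|x - 2 * dl - dl - x| <= d.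
  have -> : x - 2 * dl - dl - x = - d by rewrite /dl; field.
  by rewrite normrN ger0_norm// ltW.
have := smooth (x + 2 * dl); have := smooth (x - 2 * dl).
have := gauss_mean_logistic_le (x + 2 * dl) dl0 ep0.
have := gauss_mean_logistic_ge (x - 2 * dl) dl0 ep0.
rewrite epE => gge gle.
rewrite ler_norml => /andP[lo _]; rewrite ler_norml => /andP[_ up].
rewrite ler_norml => /andP[cl _]; rewrite ler_norml => /andP[_ cu].
have upper : shell_mean n (fun y => ((y - m) / Num.sqrt V <= x)%R%:R) <=
    shell_mean n (fun y => logistic ((u y - (x + 2 * dl)) / ep)) + e'.
  rewrite -shell_meanD_cst//; apply: shell_mean_le => y; rewrite uxn.
  apply: le_trans (_ : ((u y <= x + 2 * dl - dl)%R%:R) <= _).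
    rewrite ler_nat; have [ux|//] := leP (u y) xn.
    have -> : x + 2 * dl - dl = x + dl by ring.
    by rewrite (le_trans ux xu).
  by rewrite -epE indic_le_logistic.
have lower : shell_mean n (fun y => logistic ((u y - (x - 2 * dl)) / ep)) <=
    shell_mean n (fun y => ((y - m) / Num.sqrt V <= x)%R%:R) + e'.
  rewrite -shell_meanD_cst//; apply: shell_mean_le => y; rewrite uxn.
  apply: (@le_trans _ _ ((u y <= x - 2 * dl + dl)%R%:R + e')).
    by rewrite -epE logistic_le_indic.
  have -> : x - 2 * dl + dl = x - dl by ring.
  rewrite lerD2r ler_nat; have [ux|//] := leP (u y) (x - dl).
  by rewrite (le_trans ux xl).
have -> : e = 4 * e' by rewrite /e' mulrC divfK.
exact: sandwich_le upper up gle cu lower lo gge cl.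
Qed.

End block_sums.

(** * The uniform measure on a shell *)

Section uniform_average.
Context {R : realType} (H : nat -> nat) (n : nat).
Hypothesis Hn : (H n < H n.+1)%N.

Local Notation P := (uniform_Omega R H n).
Local Notation card := ((H n.+1 - H n)%:R : R).

Definition shell_avg (f : nat -> R) : R := (\sum_(H n <= N < H n.+1) f N) / card.

Lemma shell_avgE f :
  shell_avg f = card^-1 * \sum_(i < H n.+1 - H n) f (H n + i)%N.
Proof.
rewrite /shell_avg mulrC; congr (_ * _); rewrite -{1}[H n]add0n big_addn big_mkord.
by apply: eq_bigr => i _; rewrite addnC.
Qed.

Lemma uniform_OmegaE (A : set nat) :
  P A = (shell_avg (fun N => (N \in A)%:R))%:E.
Proof.
have cntE (X : set nat) : counting (X `&` Omega H n) =
    (\sum_(H n <= N < H n.+1) (N \in X)%:R : R)%:E :> \bar R.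
  have finX : finite_set (X `&` Omega H n).
    apply: (@sub_finite_set _ _ `I_(H n.+1)); last exact: finite_II.
    by move=> x /= [_ /andP[]].
  rewrite /counting asboolT//; congr EFin.
  have -> : fset_set (X `&` Omega H n) =
      [fset x | x in [seq x <- index_iota (H n) (H n.+1) | x \in X]]%fset.
    apply/fsetP => x; rewrite in_fset_set// !inE mem_filter mem_index_iota.
    by rewrite in_setI; congr andb; apply/idP/idP; rewrite in_setE.
  rewrite card_fseq undup_id ?filter_uniq ?iota_uniq// size_filter -sum1_count.
  by rewrite natr_sum [LHS]big_mkcond; apply: eq_bigr => N _; case: (_ \in _).
have cT := cntE setT; rewrite setTI in cT.
have cardE : \sum_(H n <= N < H n.+1) (N \in [set: nat])%:R = card.
  under eq_bigr do rewrite in_setT.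
  by rewrite sumr_const_nat.
rewrite cardE in cT.
have c0 : card != 0 by rewrite pnatr_eq0 subn_eq0 -ltnNge.
rewrite /uniform_Omega/= /mnormalize/= /mrestr setTI cT.
by rewrite eqe (negbTE c0)/= cntE -EFinM.
Qed.

(** The uniform law agrees on every set with a multiple of a finite sum of Dirac masses, against
    which integrals are finite sums. *)
Lemma ge0_integral_uniform (f : nat -> R) : (forall N, 0 <= f N) ->
  (\int[P]_N (f N)%:E = (shell_avg f)%:E)%E.
Proof.
move=> f0.
have k0 : 0 <= card^-1 by rewrite invr_ge0.
pose m := (H n.+1 - H n)%N.
pose Q := mscale (NngNum k0) (msum (fun i => \d_(H n + i)%N) m) : {measure set nat -> \bar R}.
rewrite (eq_measure_integral Q) /=; last first.
  move=> A _ _; rewrite uniform_OmegaE /Q /mscale/= /msum shell_avgE EFinM.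
  by rewrite sumEFin.
have fE0 N : [set: nat] N -> (0 <= (f N)%:E)%E by rewrite lee_fin.
rewrite ge0_integral_mscale// ge0_integral_measure_sum//=.
rewrite shell_avgE EFinM -sumEFin; congr (_ * _)%E; apply: eq_bigr => i _.
by rewrite integral_dirac//= diracT mul1e.
Qed.

Lemma integral_uniform (f : nat -> R) :
  (\int[P]_N (f N)%:E = (shell_avg f)%:E)%E.
Proof.
rewrite integralE.
have -> : (fun N => (f N)%:E)^\+%E = fun N => (Num.max (f N) 0)%:E.
  by apply/funext => N; rewrite funeposE EFin_max.
have -> : (fun N => (f N)%:E)^\-%E = fun N => (Num.max (- f N) 0)%:E.
  by apply/funext => N; rewrite funenegE EFin_max.
rewrite !ge0_integral_uniform; [|by move=> N; rewrite le_max lexx orbT..].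
rewrite -EFinB /shell_avg -mulrBl -sumrB; congr (_ / _)%:E.
apply: eq_bigr => N _.
by rewrite /Order.max; have [] := ltP (f N) 0; have [] := ltP (- f N) 0; lra.
Qed.

Lemma expectation_uniform (X : nat -> R) : ('E_P[X])%E = (shell_avg X)%:E.
Proof. by rewrite unlock integral_uniform. Qed.

Lemma variance_uniform (X : nat -> R) :
  ('V_P[X])%E = (shell_avg (fun N => (X N - shell_avg X) ^+ 2))%:E.
Proof.
rewrite /variance unlock expectation_uniform; congr (_%:E).
by congr shell_avg; apply/funext => N; rewrite expectation_uniform /= expr2.
Qed.

Lemma shell_avgB_cst (f : nat -> R) k :
  shell_avg (fun N => f N - k) = shell_avg f - k.
Proof.
rewrite /shell_avg sumrB sumr_const_nat mulrBl -[X in _ - X / _]mulr_natr mulfK//.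
by rewrite pnatr_eq0 subn_eq0 -ltnNge.
Qed.

End uniform_average.

(** * Blocks and the growth rate *)

Section growth_rate.
Context {R : realType} (L : nat) (c : nat -> nat).
Hypothesis L_gt0 : (0 < L)%N.
Hypothesis c1_gt0 : (0 < c 1)%N.
Hypothesis coef_ge2 : (1 < coef_sum c L)%N.

(** The block c_1 ... c_s j with j < c_(s+1) has [tag] s and [tagged] j; the dependent pair is a
    finite type over which the weights can be summed. *)
Definition block := {s : 'I_L & 'I_(c s.+1)}.
Definition block_length (b : block) : nat := (tag b).+1.
Definition block_digits (b : block) : nat := (coef_sum c (tag b) + tagged b)%N.

Lemma sum_blocks (V : nmodType) (F : forall s : nat, nat -> V) :
  \sum_(b : block) F (tag b) (tagged b) = \sum_(s < L) \sum_(j < c s.+1) F s j.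
Proof. by rewrite (sig_big_dep _ _ (fun (s : 'I_L) (j : 'I_(c s.+1)) => F s j)). Qed.

(** The polynomial [p] is -1 at 0 and the coefficient sum minus 1, hence positive, at 1. The
    reciprocal of its root [q] is a root of the characteristic polynomial of the recurrence. *)
Lemma growth_rate_exists :
  exists q : R, [/\ 0 < q, q < 1 & \sum_(b : block) q ^+ block_length b = 1].
Proof.
pose p : {poly R} := \sum_(s < L) (c s.+1)%:R *: 'X^(s.+1) - 1.
have pE x : p.[x] = \sum_(s < L) (c s.+1)%:R * x ^+ s.+1 - 1.
  rewrite /p hornerD hornerN hornerC horner_sum; congr (_ - _).
  by apply: eq_bigr => s _; rewrite hornerZ hornerXn.
have p0 : p.[0] = -1.
  by rewrite pE big1 ?sub0r// => s _; rewrite expr0n mulr0.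
have p1 : 0 < p.[1].
  rewrite pE subr_gt0; have : (1 : R) < (coef_sum c L)%:R by rewrite ltr1n.
  rewrite /coef_sum big_mkord natr_sum => /lt_le_trans; apply.
  by apply: ler_sum => s _; rewrite expr1n mulr1.
have [||q /andP[q0 q1] /rootP pq] := @poly_ivt R p 0 1; first exact: ler01.
  by rewrite p0 oppr_le0 ler01 ltW.
exists q; split.
- rewrite lt_neqAle q0 andbT; apply/eqP => q00; move: pq; rewrite -q00 p0 => /eqP.
  by rewrite oppr_eq0 oner_eq0.
- rewrite lt_neqAle q1 andbT; apply/eqP => q11; move: p1; rewrite -q11 pq.
  by rewrite ltxx.
rewrite (sum_blocks (fun s _ => q ^+ s.+1)).
under eq_bigr do rewrite sumr_const card_ord -mulr_natl.
by apply/eqP; rewrite -subr_eq0 -pE pq.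
Qed.

(** For L = 1 the single digit 1 is a block since c_1 >= 2. Otherwise c_1 ... c_(L-1) 0 is one, its
    last digit being allowed by c_L > 0. *)
Lemma exists_block_digits_gt0 : (0 < c L)%N -> exists b, (0 < block_digits b)%N.
Proof.
move=> cL0; have [L1|L1] := eqVneq L 1%N.
  have c1_gt1 : (1 < c (Ordinal L_gt0).+1)%N.
    by move: coef_ge2; rewrite {1}L1 /coef_sum big_nat1.
  by exists (existT _ (Ordinal L_gt0) (Ordinal c1_gt1)); rewrite /block_digits/= addn1.
have lL : (L.-1 < L)%N by rewrite ltn_predL.
have cl0 : (0 < c (Ordinal lL).+1)%N by rewrite /= prednK.
exists (existT _ (Ordinal lL) (Ordinal cl0)); rewrite /block_digits/= addn0 /coef_sum.
by rewrite big_ltn ?addn_gt0 ?c1_gt0//; move: L_gt0 L1; clear; lia.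
Qed.

End growth_rate.


(** * Linear growth, continuity points and the assembly *)

Lemma linear_growth_Theta (R : realType) (f : nat -> R) (a K : R) n0 : 0 < a ->
  (forall n, (n0 <= n)%N -> `|f n.+1 - a * n.+1%:R| <= K) ->
  f \is 'Theta_\oo (fun n => n%:R : R).
Proof.
(* The bounds a / 2 and 2 a hold as soon as |K| <= a n / 2. *)
move=> a0 fK; apply/asboolP; exists (a / 2, 2 * a) => /=.
  by rewrite divr_gt0// mulr_gt0.
have K0 : 0 <= `|K| / (a / 2) by rewrite divr_ge0// ltW// divr_gt0.
exists (n0 + Num.bound (`|K| / (a / 2))).+1 => // n /= nn.
have n_gt0 : (0 < n)%N by exact: leq_ltn_trans nn.
have Kn : `|K| <= a / 2 * n%:R.
  rewrite mulrC -ler_pdivrMr ?divr_gt0// (le_trans (ltW (archi_boundP K0)))// ler_nat.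
  by move: nn; clear; lia.
have := fK n.-1; rewrite prednK// => /(_ ltac:(move: nn; clear; lia)).
have := ler_norm K; have an0 : 0 <= a * n%:R by rewrite mulr_ge0// ltW.
rewrite (ger0_norm (ler0n R n)) ler_norml => Kle /andP[f1 f2].
have f0 : 0 <= f n by lra.
by rewrite ger0_norm//; split; lra.
Qed.

(** Convergence in distribution tests only continuity points; this puts that assumption into the
    form required by [shell_clt]. *)
Lemma gauss_cdf_continuity (R : realType) (x : R) :
  {for x, continuous (fun y : R => normal_prob (0 : R) 1 `]-oo, y]%classic)} ->
  forall e, 0 < e -> exists2 d, 0 < d & forall y, `|y - x| <= d ->
     `|gauss_cdf y - gauss_cdf x| <= e.
Proof.
move=> cx; have {}cx : gauss_cdf y @[y --> x] --> gauss_cdf x.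
  by apply: fine_cvg; rewrite gauss_cdfE.
move=> e e0; move/cvgrPdist_le/(_ e e0): cx => -[d /= d0 hd].
exists (d / 2); first by rewrite divr_gt0.
move=> y yx; rewrite distrC; apply: hd; rewrite /= distrC (le_lt_trans yx)//.
by rewrite ltr_pdivrMr//; lra.
Qed.

(** [hLc] excludes the constant sequence H = 1, for which every [Omega H n] with n > 0 is empty and
    no integer has a legal decomposition. *)
Theorem mainTheorem1 (R : realType) (L : nat) (c H : nat -> nat)
    (hH : is_PLRS L c H) (hLc : ~ (L = 1%N /\ c 1%N = 1%N)) :
  let P n := uniform_Omega R H n in
  let K n := summandsRV R L c H n in
  let K' n := nonforced_summandsRV R L c H n in
  [/\ forall N, (0 < N)%N -> exists! a, legal_decomposition_of L c H N a,
      (fun n => fine 'E_(P n)[K n]) \is 'Theta_\oo (fun n => n%:R : R)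
      /\ (fun n => fine 'V_(P n)[K n]) \is 'Theta_\oo (fun n => n%:R : R),
      forall n, (0 < n)%N -> standardize (P n) (K n) = standardize (P n) (K' n),
      cvg_in_distribution P (fun n => standardize (P n) (K n)) (normal_prob 0 1) &
      cvg_in_distribution P (fun n => standardize (P n) (K' n)) (normal_prob 0 1)].
Proof.
move=> P K K'.
have L0 := PLRS_L_gt0 hH; have c1 := PLRS_c1_gt0 hH; have cL := PLRS_cL_gt0 hH.
have c2 := coef_sum_ge2 hH hLc.
have [q [q0 q1 qsum]] := @growth_rate_exists R L c c2.
pose T := @block_length L c; pose D := @block_digits L c.
pose h m := H m.+1; pose kap := summands R L c H.
pose b0 : block L c := existT _ (Ordinal L0) (Ordinal c1).
(* The renewal argument needs windows of length at least 2, hence [L.+1]. *)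
have Tb b : (1 <= T b <= L.+1)%N by rewrite /T /block_length/= ltnS ltnW// ltn_ord.
have Db0 : D b0 = 0%N by rewrite /D /block_digits /coef_sum /= big_geq.
have [b1 Db1] : exists b, (0 < D b)%N by exact: exists_block_digits_gt0.
have h0 m : (0 < h m)%N by exact: PLRS_gt0 hH _ _.
have h_le m : (h m <= h m.+1)%N by exact: ltnW (PLRS_increasing hH hLc _).
have h_rec m (g : R -> R) : (L.+1 <= m)%N -> \sum_(0 <= N < h m) g (kap N) =
    \sum_b \sum_(0 <= N < h (m - T b)%N) g ((D b)%:R + kap N).
  move=> Lm; have := sum_num_summands_rec hH (fun k => g k%:R) (ltnW Lm).
  rewrite /h /kap /summands => ->.
  rewrite -(@sum_blocks L c _ (fun s j => \sum_(0 <= N < H (m - s.+1).+1)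
     g (coef_sum c s + j + num_summands L c H N)%:R)).
  by apply: eq_bigr => b _; apply: eq_bigr => N _; rewrite natrD.
have L1 : (1 < L.+1)%N by rewrite ltnS.
have mean_lin := shell_mean_drift L1 Tb (erefl : T b0 = 1%N) Db0 Db1 q0 q1 qsum h0 h_le h_rec.
have var_lin := shell_mean_variance L1 Tb (erefl : T b0 = 1%N) Db0 Db1 q0 q1 qsum h0 h_le h_rec.
have clt := shell_clt L1 Tb (erefl : T b0 = 1%N) Db0 Db1 q0 q1 qsum h0 h_le h_rec.
have mu0 := drift_gt0 (erefl : T b0 = 1%N) Db1 q0.
have s20 := diffusivity_gt0 (erefl : T b0 = 1%N) Db0 Db1 q0.
have Hinc n : (H n.+1 < H n.+2)%N by exact: (PLRS_increasing hH hLc).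
have EK n : fine 'E_(P n.+1)[K n.+1] = shell_mean h kap n id.
  by rewrite expectation_uniform.
have VK n : fine 'V_(P n.+1)[K n.+1] = shell_variance h kap n.
  by rewrite variance_uniform.
have std n : (0 < n)%N -> standardize (P n) (K n) = standardize (P n) (K' n).
  case: n => // n _; apply/funext => w; rewrite /standardize.
  rewrite !variance_uniform// !expectation_uniform//=.
  rewrite /nonforced_summands !shell_avgB_cst//; congr (_ / Num.sqrt _); first by ring.
  by congr shell_avg; apply/funext => N; congr (_ ^+ 2); ring.
have conv : cvg_in_distribution P (fun n => standardize (P n) (K n)) (normal_prob 0 1).
  move=> x cx.
  (* The index moves by one because shell [n] of [h] is [Omega H n.+1]; the value [H 0] is
     unconstrained, and the limit does not see n = 0. *)
  suff cv : @cdf _ _ _ (P n.+1) (standardize (P n.+1) (K n.+1)) x @[n --> \oo] --> (gauss_cdf x)%:E.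
    by rewrite -cvg_shiftS; rewrite gauss_cdfE in cv.
  have cdfE n : @cdf _ _ _ (P n.+1) (standardize (P n.+1) (K n.+1)) x = (shell_mean h kap n (fun y =>
      ((y - shell_mean h kap n id) / Num.sqrt (shell_variance h kap n) <= x)%R%:R))%:E.
    rewrite /cdf /distribution /pushforward uniform_OmegaE//; congr EFin.
    congr shell_avg; apply/funext => N; congr (_%:R : R).
    rewrite (_ : (N \in _) = (standardize (P n.+1) (K n.+1) N <= x)); last first.
      by apply/idP/idP; rewrite in_setE/= in_itv.
    by rewrite /standardize EK VK.
  rewrite (_ : (fun n => _) = fun n => (shell_mean h kap n (fun y =>
      ((y - shell_mean h kap n id) / Num.sqrt (shell_variance h kap n) <= x)%R%:R))%:E);
    last exact/funext.
  apply/fine_cvgP; split; first exact: nearW.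
  apply/cvgrPdist_le => e e0; have [n1 hn] := clt x (gauss_cdf_continuity cx) e e0.
  by exists n1 => // n /= nn; rewrite distrC; exact: hn.
split => //.
- exact: legal_decomposition_exists_unique hH hLc.
- split.
    have [Km [n0 hm]] := mean_lin.
    apply: (linear_growth_Theta (K := Km) (n0 := n0) mu0) => n nn.
    by rewrite EK; case: (hm n nn).
  have [Kv [n0 hv]] := var_lin.
  apply: (linear_growth_Theta (K := Kv) (n0 := n0) s20) => n nn.
  by rewrite VK; exact: hv.
move=> x cx; have cv := conv x cx.
have cdf_eq n : @cdf _ _ _ (P n.+1) (standardize (P n.+1) (K' n.+1)) x =
    @cdf _ _ _ (P n.+1) (standardize (P n.+1) (K n.+1)) x.
  rewrite /cdf /distribution /pushforward; congr (uniform_Omega R H n.+1 _).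
  by apply/funext => w; rewrite /preimage/= std.
rewrite -cvg_shiftS in cv; rewrite -cvg_shiftS.
rewrite (_ : [sequence _]_n = (fun n =>
  @cdf _ _ _ (P n.+1) (standardize (P n.+1) (K n.+1)) x)); first exact: cv.
exact/funext.
Qed.
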